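(* Let $w,w'$ be row strict tableaux of type $(i_1,\dots,i_m)$. Then $\widetilde Y_w\cap\widetilde Y_{w'}=\emptyset$ if and only if the circle diagram $CC(w,w')$ contains at least one red circle.
   Context: Setting: $n\ge2k\ge0$; $V$ has basis $e_1,\dots,e_{n-k},f_1,\dots,f_k$; $Ne_i=e_{i-1}$, $Nf_i=f_{i-1}$, $e_0=f_0=0$. For $0<i_1<\dots<i_m=n$, $\widetilde Y=\mathrm{Sp}(i_1,\dots,i_m)$ is the variety of partial flags $F_{i_1}\subset\dots\subset F_{i_m}$ ($\dim F_{i_l}=i_l$) with $NF_{i_l}\subset F_{i_{l-1}}$ ($F_{i_0}=\{0\}$). A row strict tableau of type $(i_1,\dots,i_m)$: two rows (top $n-k$ boxes, bottom $k$), $i_l$ occurring $i_l-i_{l-1}$ times, strictly decreasing rows; double entries: $i_l$ with $i_l-i_{l-1}=2$; $w_\wedge,w_\vee,w_\times$: top-row entries, bottom-row entries, double entries. $\mathcal F_{i_l}(w)=\langle e_j,f_r:j\le t_{i_l},r\le b_{i_l}\rangle$, $t_s$ ($b_s$) the number of entries $\le s$ in the top (bottom) row. With $P=\langle e_1,\dots,e_{n-k}\rangle$, $Q=\langle f_1,\dots,f_k\rangle$, $\rho:V\to Q$ the projection along $P$ and $F'_{i_l}=(F_{i_l}\cap P)+\rho(F_{i_l})$, $\widetilde Y_w$ is the Zariski closure of $\{F\in\widetilde Y: F'=\mathcal F(w)\}$. Extended cup diagram $eC(w)$: weight sequence $a_1\dots a_n$ ($a_{i-1}=a_i=\times$ for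 $i\in w_\times$, else $\wedge$ for $i\in w_\wedge$, $\vee$ for $i\in w_\vee$), with $n-k$ points $\vee$ prepended at positions $-(n-k)+1,\dots,0$ and $k$ points $\wedge$ appended at positions $n+1,\dots,n+k$; repeatedly join by cups the $\vee\wedge$ pairs adjacent after ignoring $\times$'s and joined points, until all non-$\times$ points of $1,\dots,n$ are joined; delete the unused added points. Cups with an endpoint at an added point are green, others black. Points of position $<1$ are left outer points, of position $>n$ right outer points. Circle diagram $CC(w,w')$: draw $eC(w)$ with its cups below a horizontal line and the mirror image of $eC(w')$ (cups above the line) on the same points. If one of the two diagrams has outer points not present in the other (such extra points occur equally often on the left and on the right), these extra points are joined, on the side lacking them, by green arcs in the unique crossingless way. The result is a disjoint union of closed curves (circles). A circle is coloured red if it contains more than one left outer point or more than one right outer point; otherwise it is green if it contains at least one green arc, and black otherwise. *)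

(* Defs.v *)
From HB Require Import structures.
From mathcomp Require Import all_boot all_order all_algebra.
Import Order.TTheory GRing.Theory Num.Theory.

Definition ii (I : seq nat) (l : nat) : nat :=
  if l is l'.+1 then nth 0%N I l' else 0%N.

Definition valid_type (n : nat) (I : seq nat) : Prop :=
  [/\ I != [::], sorted ltn I, (0 < head 0%N I)%N & last 0%N I = n].

Definition mult (I : seq nat) (j : nat) : nat :=
  \sum_(1 <= l < (size I).+1) (if ii I l == j then ii I l - ii I l.-1 else 0)%N.

(* A two-row tableau: (top row, bottom row), each read left to right. *)
Definition tableau := (seq nat * seq nat)%type.

Definition is_rst (n k : nat) (I : seq nat) (w : tableau) : Prop :=
  [/\ size w.1 = (n - k)%N, size w.2 = k,
      sorted gtn w.1, sorted gtn w.2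
    & forall j, count_mem j (w.1 ++ w.2) = mult I j].

Definition wx (I : seq nat) : seq nat :=
  [seq ii I l | l <- iota 1 (size I) & (ii I l - ii I l.-1 == 2)%N].

(* Positions -(n-k)+1, ..., n+k are encoded by s = pos + (n-k) - 1,     *)
(* i.e. s = 0, ..., 2n-1.  Left outer: s < n-k; inner (positions 1..n): *)
(* n-k <= s < 2n-k; right outer: s >= 2n-k.                             *)

Inductive sym := Up (* wedge *) | Dn (* vee *) | Cr (* cross *).

Definition is_up (a : sym) := if a is Up then true else false.
Definition is_dn (a : sym) := if a is Dn then true else false.
Definition is_cr (a : sym) := if a is Cr then true else false.
Definition symval (a : sym) : int :=
  match a with Dn => 1 | Up => -1 | Cr => 0 end%R.

Definition wt (I : seq nat) (w : tableau) (i : nat) : sym :=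
  if (i \in wx I) || (i.+1 \in wx I) then Cr
  else if i \in w.1 then Up else Dn.

Definition ewt (n k : nat) (I : seq nat) (w : tableau) (s : nat) : sym :=
  if (s < n - k)%N then Dn
  else if (s < 2 * n - k)%N then wt I w (s - (n - k)).+1
  else Up.

Definition inner (n k s : nat) : bool := (n - k <= s)%N && (s < 2 * n - k)%N.
Definition louter (n k s : nat) : bool := (s < n - k)%N.
Definition router (n k s : nat) : bool := (2 * n - k <= s)%N && (s < 2 * n)%N.

Definition dep (n k : nat) (I : seq nat) (w : tableau) (s t : nat) : int :=
  (\sum_(s.+1 <= r < t) symval (ewt n k I w r))%R.

(* (s,t) is a cup of eC(w): the vee at s is joined to the wedge at t, the
   first wedge to the right of s such that all non-cross points strictly
   between are already joined among themselves (the outcome of repeatedly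
   joining neighbouring vee-wedge pairs), and at least one endpoint is one
   of the points 1..n (cups between two added points are never drawn). *)
Definition cup (n k : nat) (I : seq nat) (w : tableau) (s t : nat) : bool :=
  [&& (s < t)%N, (t < 2 * n)%N, is_dn (ewt n k I w s), is_up (ewt n k I w t),
      dep n k I w s t == 0%R,
      all (fun r => ~~ (is_up (ewt n k I w r) && (dep n k I w s r == 0%R)))
          (iota s.+1 (t - s.+1))
    & inner n k s || inner n k t].

Definition used (n k : nat) (I : seq nat) (w : tableau) (p : nat) : bool :=
  has (fun t => cup n k I w p t || cup n k I w t p) (iota 0 (2 * n)).

Definition extra (n k : nat) (I : seq nat) (x y : tableau) (p : nat) : bool :=
  used n k I y p && ~~ used n k I x p.

(* green arcs joining, on the side of x, the extra points (used by y but not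
   by x) in the crossingless (nested) way: the j-th extra left point counted
   from the inside is joined with the j-th extra right point counted from
   the inside. *)
Definition xarc (n k : nat) (I : seq nat) (x y : tableau) (p q : nat) : bool :=
  [&& louter n k p, router n k q, extra n k I x y p, extra n k I x y q &
      count (extra n k I x y) (iota p.+1 (n - k - p.+1)) ==
      count (extra n k I x y) (iota (2 * n - k) (q - (2 * n - k)))].

Definition arc (n k : nat) (I : seq nat) (x y : tableau) (p q : nat) : bool :=
  [|| cup n k I x p q, cup n k I x q p, xarc n k I x y p q | xarc n k I x y q p].

Definition present (n k : nat) (I : seq nat) (w w' : tableau) (p : nat) : bool :=
  [|| inner n k p && ~~ is_cr (ewt n k I w p), used n k I w p | used n k I w' p].

(* adjacency in CC(w,w'): lower arcs (from eC(w)) and upper arcs (mirror of eC(w')) *)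
Definition ccrel (n k : nat) (I : seq nat) (w w' : tableau) : rel 'I_(2 * n) :=
  fun p q => arc n k I w w' p q || arc n k I w' w p q.

Definition has_red_circle (n k : nat) (I : seq nat) (w w' : tableau) : Prop :=
  exists p : 'I_(2 * n), present n k I w w' p /\
    ((1 < #|[pred q : 'I_(2 * n) | connect (ccrel n k I w w') p q && louter n k q]|)%N
     \/ (1 < #|[pred q : 'I_(2 * n) | connect (ccrel n k I w w') p q && router n k q]|)%N).

(* Linear algebra: V = C^n as row vectors; basis vector e_j (1<=j<=n-k) *)
(* is the (j-1)-th unit row vector, f_r (1<=r<=k) the (n-k+r-1)-th.     *)
(* Subspaces are row spaces of n x n matrices (mxalgebra).              *)

Local Open Scope ring_scope.

(* N acts on row vectors by right multiplication: e_j N = e_{j-1}, f_r N = f_{r-1} *)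
Definition Nmx (C : fieldType) (n k : nat) : 'M[C]_n :=
  \matrix_(i, j) (((j.+1 == i :> nat) && (i != n - k :> nat))%N)%:R.

(* P = <e_1,...,e_{n-k}>, and the projection rho : V -> Q along P *)
Definition Pmx (C : fieldType) (n k : nat) : 'M[C]_n :=
  \matrix_(i, j) ((i == j) && (i < n - k)%N)%:R.
Definition Qmx (C : fieldType) (n k : nat) : 'M[C]_n :=
  \matrix_(i, j) ((i == j) && (n - k <= i)%N)%:R.

(* F_{i_l}(w) = <e_j, f_r : j <= t_{i_l}, r <= b_{i_l}> *)
Definition Fw (C : fieldType) (n k : nat) (I : seq nat) (w : tableau) (l : nat)
  : 'M[C]_n :=
  let t := count (fun x => x <= ii I l)%N w.1 in
  let b := count (fun x => x <= ii I l)%N w.2 in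
  \matrix_(i, j) ((i == j) && ((i < t)%N || ((n - k <= i)%N && (i < n - k + b)%N)))%:R.

(* a partial flag is a function l |-> F_{i_l} (l = 1..m); F_{i_0} = 0 *)
Definition flag (C : fieldType) (n : nat) := nat -> 'M[C]_n.
Definition fl (C : fieldType) (n : nat) (F : flag C n) (l : nat) : 'M[C]_n :=
  if l is 0 then 0 else F l.
Arguments fl {C n}.

Definition is_flag (C : fieldType) (n : nat) (I : seq nat) (F : flag C n) : Prop :=
  forall l, (0 < l <= size I)%N ->
    \rank (F l) = ii I l /\ (fl F l.-1 <= F l)%MS.
Arguments is_flag {C n}.

Definition inY (C : fieldType) (n k : nat) (I : seq nat) (F : flag C n) : Prop :=
  is_flag I F /\
  forall l, (0 < l <= size I)%N -> (F l *m Nmx C n k <= fl F l.-1)%MS.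
Arguments inY {C n}.

Definition Fprime (C : fieldType) (n k : nat) (F : flag C n) (l : nat) : 'M[C]_n :=
  (F l :&: Pmx C n k + F l *m Qmx C n k)%MS.
Arguments Fprime {C n}.

Definition Ycell (C : fieldType) (n k : nat) (I : seq nat) (w : tableau)
  (F : flag C n) : Prop :=
  inY k I F /\
  forall l, (0 < l <= size I)%N -> (Fprime k F l == Fw C n k I w l)%MS.
Arguments Ycell {C n}.

Inductive polyfun (C : fieldType) (n : nat) : ('M[C]_n -> C) -> Prop :=
| pf_const (c : C) : polyfun C n (fun _ => c)
| pf_coord (i j : 'I_n) : polyfun C n (fun g => g i j)
| pf_add p q : polyfun C n p -> polyfun C n q -> polyfun C n (fun g => p g + q g)
| pf_mul p q : polyfun C n p -> polyfun C n q -> polyfun C n (fun g => p g * q g).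
Arguments polyfun {C n}.

Definition flag_of (C : fieldType) (n : nat) (I : seq nat) (g : 'M[C]_n) : flag C n :=
  fun l => \matrix_(r, c) (if (r < ii I l)%N then g r c else 0).
Arguments flag_of {C n}.

Definition flag_eq (C : fieldType) (n : nat) (I : seq nat) (F G : flag C n) : Prop :=
  forall l, (0 < l <= size I)%N -> (F l == G l)%MS.
Arguments flag_eq {C n}.

(* Zariski closure in the partial flag variety GL_n / P_I, computed via the
   (open, surjective) quotient map GL_n -> flags, g |-> flag_of g: F lies in
   the closure of S iff every polynomial function vanishing on all g in GL_n
   with flag_of g in S also vanishes on all g in GL_n representing F. *)
Definition zclosure (C : fieldType) (n : nat) (I : seq nat)
  (S : flag C n -> Prop) (F : flag C n) : Prop :=
  is_flag I F /\
  forall p : 'M[C]_n -> C, polyfun p ->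
    (forall g, g \in unitmx -> S (flag_of I g) -> p g = 0) ->
    forall g, g \in unitmx -> flag_eq I (flag_of I g) F -> p g = 0.

Definition Ytil (C : fieldType) (n k : nat) (I : seq nat) (w : tableau) : flag C n -> Prop :=
  @zclosure C n I (Ycell k I w).
Arguments zclosure {C n}.
Arguments Ytil {C n}.

(* Main.v *)
(* A frame g in GL_n represents the flag whose members G_l are spanned by the
   first l rows of g.  The closure of the cell of w is cut out by closed
   conditions on G (the record closed_cell): N G_l <= G_{l'} for consecutive
   levels l' < l, N^c G_j <= G_{i-1} for every black cup (i, j) with
   2c = j - i + 1, and rho(G_l) <= <f_1, ..., f_b> with b the number of bottom
   entries of w that are <= l.  Conversely, given a flag satisfying them, look at
   the first level i at which rho(G_i) is smaller than in the cell.  A black cup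
   (i, j) starts there, G_j / G_{i-1} is free of rank two over C[N]/N^c, and
   moving the G_l with i <= l < j along a nilpotent C[N]-endomorphism of this
   quotient yields a line of flags satisfying the conditions, whose generic point
   agrees with the cell up to level i; so the flag is in the closure.

   For a flag in both closures the numbers dim rho(G_l) orient eC(w) and eC(w')
   simultaneously, with vee at the left and wedge at the right outer points;
   conversely, the coordinate flag of such an orientation lies in both closures.
   As the arcs do not cross, an even number of points of a circle lies below each
   of its arcs, so the only alternating labellings of a circle are given by the
   parity of the number of points of the circle to the left.  Hence an
   orientation exists if and only if no circle has two outer points on the same
   side. *)

(* Flags and diagrams meet in the function beta i = dim rho(F_i). An inclusion N^q F_b <= F_a leaves
   on it the two inequalities of [slow], since N loses at most one dimension per step on each of the
   Jordan blocks P and Q; conversely, the coordinate flag of beta satisfies the inclusion as soon as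
   beta satisfies the inequalities. An [admissible] beta and an orientation determine each other's
   existence: beta grows by one at the vees and at the double entries.

   The closure is tested by polynomials on GL_n. Therefore N^q G_b <= G_a is read as the vanishing
   of a block of g N^q adj(g), and the deformation is a genuine line g + x H, on which a polynomial
   vanishing for all but finitely many x vanishes everywhere.

   The green arcs need no separate treatment. Each side of the circle diagram is thus one
   noncrossing matching. *)
Require Import Defs.
From HB Require Import structures.
From mathcomp Require Import all_boot all_order all_algebra.
From mathcomp Require Import complex reals.
From mathcomp Require Import zify.
Set Implicit Arguments. Unset Strict Implicit. Unset Printing Implicit Defensive.
Import Order.TTheory GRing.Theory Num.Theory.

(** * Labellings of noncrossing circles *)

Lemma even_card_matching (T : finType) (M : rel T) (A : {set T}) :
  symmetric M -> irreflexive M ->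
  (forall x y z, M x y -> M x z -> y = z) ->
  (forall x, x \in A -> exists2 y, y \in A & M x y) -> ~~ odd #|A|.
Proof.
move=> Msym Mirr Mfun; have [m] := ubnP #|A|; elim: m A => // m IH A ltAm tot.
have [->|[x xA]] := set_0Vmem A; first by rewrite cards0.
have [y yA xy] := tot x xA.
have nxy : y != x by apply: contraTneq xy => ->; rewrite Mirr.
have yAx : y \in A :\ x by rewrite !inE nxy.
have cA : #|A| = #|A :\ x :\ y|.+2.
  by rewrite (cardsD1 x A) xA (cardsD1 y (A :\ x)) yAx.
rewrite cA /= negbK; apply: IH; first by move: ltAm; rewrite cA; lia.
move=> z; rewrite !inE => /and3P[zy zx zA].
have [u uA zu] := tot z zA; exists u => //; rewrite !inE uA andbT.
apply/andP; split; apply: contraTneq zu => ->; rewrite Msym.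
  by apply: contra zx => yz; rewrite Msym in xy; rewrite (Mfun _ _ _ xy yz).
by apply: contra zy => xz; rewrite (Mfun _ _ _ xy xz).
Qed.

Lemma two_least N (A : {set 'I_N}) : 1 < #|A| ->
  exists u v : 'I_N, [/\ u \in A, v \in A, u < v & forall t, t \in A -> t != u -> v <= t].
Proof.
case/card_gt1P=> y [z [yA zA nyz]].
have [u uA umin] := @arg_minnP _ y (fun i => i \in A) val yA.
have [v0 v0P] : exists v, (v \in A) && (v != u).
  case: (eqVneq y u) => [yu|yu]; last by exists y; rewrite yA.
  by exists z; rewrite zA -yu eq_sym.
have [v /andP[vA vu] vmin] := @arg_minnP _ v0 (fun i => (i \in A) && (i != u)) val v0P.
exists u, v; split=> // [|t tA tu]; last by apply: vmin; rewrite tA.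
by rewrite ltn_neqAle umin // andbT eq_sym.
Qed.

Lemma two_greatest N (A : {set 'I_N}) : 1 < #|A| ->
  exists u v : 'I_N, [/\ u \in A, v \in A, v < u & forall t, t \in A -> t != u -> t <= v].
Proof.
case/card_gt1P=> y [z [yA zA nyz]].
have [u uA umax] := @arg_maxnP _ y (fun i => i \in A) val yA.
have [v0 v0P] : exists v, (v \in A) && (v != u).
  case: (eqVneq y u) => [yu|yu]; last by exists y; rewrite yA.
  by exists z; rewrite zA -yu eq_sym.
have [v /andP[vA vu] vmax] := @arg_maxnP _ v0 (fun i => (i \in A) && (i != u)) val v0P.
exists u, v; split=> // [|t tA tu]; last by apply: vmax; rewrite tA.
by rewrite ltn_neqAle [v <= u]umax // andbT.
Qed.

Section PerfectMatching.

Variables (N : nat) (pres lo ro : pred 'I_N).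
Hypothesis lo_down : forall x y : 'I_N, x <= y -> lo y -> lo x.
Hypothesis ro_up : forall x y : 'I_N, x <= y -> ro x -> ro y.

(** Partners are demanded for the points of [pres] only, but [M] may join other points too: the
    arches to which this is applied include those between added points that neither diagram uses. *)
Definition noncrossing_matching (M : rel 'I_N) :=
  [/\ symmetric M, irreflexive M,
      forall x y z, M x y -> M x z -> y = z,
      forall x y, M x y -> pres x -> pres y
    & (forall x, pres x -> exists y, M x y) /\
      (forall x y z t : 'I_N, M x y -> M z t -> x < z -> z < y -> x < t < y)].

Variables M M' : rel 'I_N.
Hypothesis HM : noncrossing_matching M.
Hypothesis HM' : noncrossing_matching M'.
Let e : rel 'I_N := fun x y => pres x && (M x y || M' x y).

Let e_sym : symmetric e.
Proof.
have [Ms _ _ Mp _] := HM; have [Ms' _ _ Mp' _] := HM'.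
suff E x y : e x y -> e y x by move=> x y; apply/idP/idP; apply: E.
case/andP=> px /orP[xy|xy]; rewrite /e.
  by rewrite (Mp _ _ xy px) Ms xy.
by rewrite (Mp' _ _ xy px) (Ms' y x) xy orbT.
Qed.

Let csym : connect_sym e := sym_connect_sym e_sym.

Let esubM : subrel e (connect e) := connect1 (e:=e).

Lemma pres_connect x y : connect e x y -> pres x -> pres y.
Proof.
case/connectP=> p pth ->; elim: p x pth => //= z p IH x /andP[xz pth] px.
apply: IH pth _; have [_ _ _ Mp _] := HM; have [_ _ _ Mp' _] := HM'.
by case/andP: xz => _ /orP[/Mp|/Mp']; apply.
Qed.

Let cls x := [set y | connect e x y].
Let idx (x : 'I_N) := #|[set y in cls x | y < x]|.

Let cls_eq x y : connect e x y -> cls x = cls y.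
Proof.
move=> xy; apply/setP=> z; rewrite !inE; apply/idP/idP => [|]; apply: connect_trans => //.
by rewrite csym.
Qed.

Let between_even (L : rel 'I_N) x y : noncrossing_matching L ->
  (forall u v, pres u -> L u v -> e u v) -> pres x -> L x y ->
  ~~ odd #|[set z in cls x | x < z < y]|.
Proof.
move=> [Ls Li Lf Lp [Lt Lx]] Le px xy; apply: (even_card_matching Ls Li Lf) => z.
rewrite !inE => /and3P[xz ltxz ltzy].
have pz := pres_connect xz px; have [t zt] := Lt _ pz.
exists t => //; rewrite !inE (connect_trans xz (esubM (Le _ _ pz zt))) /=.
exact: Lx xy zt ltxz ltzy.
Qed.

Let class_even x : pres x -> ~~ odd #|cls x|.
Proof.
move=> px; have [Ls Li Lf Lp [Lt Lx]] := HM; apply: (even_card_matching Ls Li Lf) => z.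
rewrite !inE => xz; have pz := pres_connect xz px; have [t zt] := Lt _ pz.
exists t => //; rewrite !inE; apply: connect_trans xz (esubM _).
by rewrite /e pz zt.
Qed.

Lemma idx_arc x y : e x y -> odd (idx y) = ~~ odd (idx x).
Proof.
wlog ltxy : x y / x < y.
  move=> W exy; have nxy : x != y.
    apply: contraTneq exy => ->; rewrite /e.
    by have [_ -> _ _ _] := HM; have [_ -> _ _ _] := HM'; rewrite andbF.
  have := nxy; rewrite -val_eqE neq_ltn => /orP[h|h]; first exact: W h exy.
  by have := W y x h; rewrite e_sym => /(_ exy) ->; rewrite negbK.
move=> exy; have E : ~~ odd #|[set z in cls x | x < z < y]|.
  case/andP: (exy) => px /orP[h|h]; [apply: (between_even HM)|apply: (between_even HM')] => //;
  by move=> u v pu uv; rewrite /e pu uv ?orbT.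
rewrite /idx -(cls_eq (esubM exy)).
rewrite (cardsD1 x) !inE connect0 ltxy /=.
set A := _ :\ x; have -> : A = [set y0 in cls x | y0 < x] :|: [set z in cls x | x < z < y].
  apply/setP=> z; rewrite !inE -val_eqE /=.
  by case: connect; rewrite ?andbF //=; lia.
rewrite cardsU (_ : _ :&: _ = set0) ?cards0 ?subn0 ?oddD; last first.
  by apply/setP=> z; rewrite !inE; case: connect => //=; lia.
by rewrite (negbTE E) addbF.
Qed.

(** For an alternating l, the sum of l and the parity of [idx] is constant on a circle. As [lo] is
    an initial segment, the two leftmost left outer points of a circle have consecutive indices and
    hence different labels; similarly for the two rightmost right outer points. Conversely, label by
    even index: a lone left outer point has index 0, and a lone right outer point comes last in a
    circle of even size, so its index is odd. *)
Lemma no_red_circleP :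
  (exists l : pred 'I_N,
     [/\ forall x y, e x y -> l x != l y,
         forall x, pres x -> lo x -> l x & forall x, pres x -> ro x -> ~~ l x]) <->
  (forall x, pres x ->
     #|[pred y | connect e x y && lo y]| <= 1 /\ #|[pred y | connect e x y && ro y]| <= 1).
Proof.
split=> [[l [l_alt l_lo l_ro]] x px|H].
  have inv y z : connect e y z -> l y (+) odd (idx y) = l z (+) odd (idx z).
    case/connectP=> p pth ->; elim: p y pth => //= u p IH y /andP[yu pth].
    rewrite -(IH _ pth) (idx_arc yu); have := l_alt _ _ yu.
    by case: (l y); case: (l u); case: odd.
  split; rewrite leqNgt -cardsE; apply/negP.
  - case/two_least=> u [v [uA vA ltuv vmin]].
    move: (uA) (vA); rewrite !inE => /andP[xu lu] /andP[xv lv].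
    have uv : connect e u v by apply: connect_trans xv; rewrite csym.
    have iE : idx v = (idx u).+1.
      rewrite /idx (cls_eq uv) (cardsD1 u) !inE ltuv csym uv /= add1n; congr _.+1.
      apply: eq_card => t; rewrite !inE -val_eqE /=.
      case vt: (connect e v t); rewrite ?andbF //=.
      apply/andP/idP => [[nut ltv]|ltu]; last by rewrite (ltn_eqF ltu) (ltn_trans ltu ltuv).
      rewrite ltnNge; apply/negP => leut.
      have tA : t \in [set y | connect e x y && lo y].
        by rewrite inE (connect_trans xv vt) (lo_down _ lv) // ltnW.
      by move: ltv; rewrite ltnNge vmin.
    have := inv _ _ uv; rewrite iE l_lo ?l_lo ?(pres_connect xu) ?(pres_connect xv) //=.
    by case: odd.
  - case/two_greatest=> u [v [uA vA ltvu vmax]].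
    move: (uA) (vA); rewrite !inE => /andP[xu lu] /andP[xv lv].
    have uv : connect e v u by apply: connect_trans xu; rewrite csym.
    have iE : idx u = (idx v).+1.
      rewrite /idx (cls_eq uv) (cardsD1 v) !inE ltvu csym uv /= add1n; congr _.+1.
      apply: eq_card => t; rewrite !inE -val_eqE /=.
      case vt: (connect e u t); rewrite ?andbF //=.
      apply/andP/idP => [[nut ltv]|ltu]; last by rewrite (ltn_eqF ltu) (ltn_trans ltu ltvu).
      rewrite ltnNge; apply/negP => leut.
      have tA : t \in [set y | connect e x y && ro y].
        by rewrite inE (connect_trans xu vt) (ro_up _ lv).
      by move: nut; rewrite eqn_leq leut vmax // -val_eqE /= (ltn_eqF ltv).
    have := inv _ _ uv; rewrite iE.
    have := l_ro _ (pres_connect xu px) lu; have := l_ro _ (pres_connect xv px) lv.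
    by case: (l u); case: (l v) => //=; case: odd.
exists (fun x => ~~ odd (idx x)); split=> [x y /idx_arc ->|x px lx|x px rx].
- by case: odd.
- suff -> : idx x = 0 by [].
  apply: eq_card0 => y; rewrite !inE; apply/andP => -[xy ltyx].
  have [+ _] := H x px; rewrite leqNgt => /negP; apply.
  apply/card_gt1P; exists x, y; rewrite !inE connect0 lx xy (lo_down (ltnW ltyx) lx); split=> //.
  by rewrite -val_eqE /=; lia.
- suff E : #|cls x| = (idx x).+1 by have := class_even px; rewrite E negbK /= => ->.
  rewrite (cardsD1 x) !inE connect0 add1n; congr _.+1.
  apply: eq_card => y; rewrite !inE -val_eqE /=; case xy: (connect e x y); rewrite ?andbF //=.
  rewrite andbT; apply/idP/idP => [nyx|]; last by lia.
  rewrite ltnNge; apply/negP => lexy.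
  have [_ +] := H x px; rewrite leqNgt => /negP; apply.
  apply/card_gt1P; exists x, y; rewrite !inE connect0 rx xy (ro_up lexy rx); split=> //.
  by rewrite eq_sym.
Qed.

End PerfectMatching.

(** * Arches *)

Section BracketSequence.

Variables (L : nat) (a : nat -> sym).

Definition height (s : nat) : int := (\sum_(0 <= r < s) symval (a r))%R.

Definition arch (s t : nat) : bool :=
  [&& s < t, t < L, is_dn (a s), is_up (a t),
      (\sum_(s.+1 <= r < t) symval (a r))%R == 0%R
    & all (fun r => ~~ (is_up (a r) && ((\sum_(s.+1 <= r' < r) symval (a r'))%R == 0%R)))
          (iota s.+1 (t - s.+1))].

Lemma height0 : height 0 = 0%R.
Proof. by rewrite /height big_geq. Qed.

Lemma heightS s : height s.+1 = (height s + symval (a s))%R.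
Proof. by rewrite /height big_nat_recr. Qed.

Lemma height_sum s t : s <= t -> (\sum_(s <= r < t) symval (a r) = height t - height s)%R.
Proof.
move=> st; rewrite /height [X in (X - _)%R](big_cat_nat (n := s)) //=.
by rewrite addrAC subrr add0r.
Qed.

Lemma height_dn s : is_dn (a s) -> height s.+1 = (height s + 1)%R.
Proof. by rewrite heightS; case: (a s). Qed.

Lemma height_up s : is_up (a s) -> height s.+1 = (height s - 1)%R.
Proof. by rewrite heightS; case: (a s). Qed.

Lemma height_not_up s : ~~ is_up (a s) -> (height s <= height s.+1)%R.
Proof. by rewrite heightS; case: (a s) => //= _; lia. Qed.

Lemma height_not_dn s : ~~ is_dn (a s) -> (height s.+1 <= height s)%R.
Proof. by rewrite heightS; case: (a s) => //= _; lia. Qed.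

Lemma height_step s : (height s - 1 <= height s.+1 <= height s + 1)%R.
Proof. by rewrite heightS; case: (a s) => /=; lia. Qed.

(* An arch is an excursion of the height function above its starting level. *)
Lemma archP s t : reflect
  [/\ s < t < L, is_dn (a s), is_up (a t), height t.+1 = height s
    & forall r, s < r <= t -> (height s < height r)%R]
  (arch s t).
Proof.
apply: (iffP and5P) => [[st tL ds ut /andP[/eqP E0 /allP A]]|[/andP[st tL] ds ut E H]].
  have Et : height t = (height s + 1)%R.
    by rewrite -(height_dn ds); apply/eqP; rewrite -subr_eq0 -height_sum // E0.
  split=> //; first by rewrite st.
    by rewrite (height_up ut) Et addrK.
  elim=> // r IH /andP[sr rt]; move: sr; rewrite ltnS leq_eqVlt => /orP[/eqP <-|sr].
    by rewrite (height_dn ds); lia.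
  have {}IH : (height s < height r)%R by apply: IH; rewrite sr ltnW.
  have rI : r \in iota s.+1 (t - s.+1) by rewrite mem_iota; lia.
  move: (A r rI); have [ur|nu _] := boolP (is_up (a r)); last first.
    by have := height_not_up nu; lia.
  rewrite /= height_sum // (height_dn ds) (height_up ur) subr_eq0 => /eqP; lia.
have Et : height t = (height s + 1)%R by move: E; rewrite (height_up ut); lia.
split=> //; apply/andP; split.
  by rewrite height_sum // Et (height_dn ds) subrr.
apply/allP=> r; rewrite mem_iota => rI; apply/negP => /andP[ur].
rewrite height_sum; last by lia.
rewrite (height_dn ds) subr_eq0 => /eqP Er.
have : (height s < height r.+1)%R by apply: H; lia.
by rewrite (height_up ur); lia.
Qed.

Lemma arch_left_uniq s s' t : arch s t -> arch s' t -> s = s'.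
Proof.
move=> /archP[/andP[st tL] ds ut E H] /archP[/andP[s't _] ds' _ E' H'].
case: (ltngtP s s') => // lt; [have := H s'|have := H' s]; lia.
Qed.

Lemma arch_right_uniq s t t' : arch s t -> arch s t' -> t = t'.
Proof.
move=> /archP[/andP[st tL] ds ut E H] /archP[/andP[st' _] _ ut' E' H'].
case: (ltngtP t t') => // lt; [have := H' t.+1|have := H t'.+1]; lia.
Qed.

Lemma arch_noncrossing s t s' t' : arch s t -> arch s' t' -> s < s' < t -> t' < t.
Proof.
move=> /archP[/andP[st tL] ds ut E H] /archP[/andP[s't' _] ds' ut' E' H'] lt.
have hs' : (height s < height s')%R by apply: H; lia.
case: (ltngtP t' t) => // [tt'|t't]; last by move: E'; rewrite t't E; lia.
by have := H' t.+1; lia.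
Qed.

Lemma arch_noncrossing_left s t s' t' : arch s t -> arch s' t' -> s < t' < t -> s < s'.
Proof.
move=> st st' lt; case: (ltngtP s s') => // [s's|ss'].
  by have := arch_noncrossing st' st; lia.
by rewrite -ss' in st'; have := arch_right_uniq st st'; lia.
Qed.

Lemma arch_asym s s' t : arch s t -> arch t s' = false.
Proof.
move=> /archP[_ _ ut _ _]; apply/negP => /archP[_ dt _ _ _].
by move: ut dt; case: (a t).
Qed.

Hypothesis height_ge0 : forall s, s <= L -> (0 <= height s)%R.
(** The left end is the last position before t at which the height is smaller than at t; as heights
    move by at most one, the symbol there is a vee. *)
Lemma ex_arch_left t : t < L -> is_up (a t) -> exists s, arch s t.
Proof.
move=> tL ut.
have h1 : (0 < height t)%R by have := height_ge0 tL; rewrite (height_up ut); lia.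
have ex : exists s, (s <= t) && (height s < height t)%R.
  by exists 0; rewrite height0.
have ub s : (s <= t) && (height s < height t)%R -> s <= t by case/andP.
have [s /andP[st hs] smax] := ex_maxnP ex ub.
have {st}st : s < t by move: st; rewrite leq_eqVlt => /orP[/eqP E|//]; move: hs; rewrite E ltxx.
have H r : s < r <= t -> (height t <= height r)%R.
  move=> /andP[sr rt]; rewrite leNgt; apply/negP => hr.
  by have := smax r; rewrite rt hr => /(_ isT); lia.
have Hs := H s.+1; rewrite ltnS leqnn st in Hs; have {}Hs := Hs isT.
have step := height_step s.
exists s; apply/archP; split=> //; first by rewrite st.
- apply: contraTT isT => nd; have := height_not_dn nd; lia.
- by rewrite height_up //; lia.
- by move=> r /H; lia.
Qed.

Hypothesis heightL : height L = 0%R.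

(** The right end is the first position after which the height is back at its value in s; the final
    height 0 guarantees one. *)
Lemma ex_arch_right s : s < L -> is_dn (a s) -> exists t, arch s t.
Proof.
move=> sL ds.
have ex : exists t, (s < t) && (height t.+1 <= height s)%R.
  have := height_ge0 (ltnW sL); have := height_dn ds; have := heightL.
  case: L sL => // l; rewrite ltnS leq_eqVlt => /orP[/eqP <-|sl] *; first by lia.
  by exists l; rewrite sl; lia.
have [t /andP[st ht] tmin] := ex_minnP ex.
have tL : t < L.
  rewrite ltnNge; apply/negP => Lt.
  have := tmin L.-1; have := height_ge0 (ltnW sL); have := height_dn ds; have := heightL.
  case: (L) sL Lt => // l; rewrite ltnS leq_eqVlt => /orP[/eqP <-|sl] /= lt *; first by lia.
  have : (s < l) && (height l.+1 <= height s)%R by rewrite sl; lia.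
  by lia.
have H r : s < r <= t -> (height s < height r)%R.
  case: r => // r /andP[]; rewrite ltnS leq_eqVlt => /orP[/eqP <- _|sr rt].
    by rewrite height_dn //; lia.
  rewrite ltNge; apply/negP => le.
  by have := tmin r; rewrite sr le => /(_ isT); lia.
have Ht := H t; rewrite st leqnn in Ht; have {}Ht := Ht isT.
have step := height_step t.
exists t; apply/archP; split=> //; first by rewrite st.
- apply: contraTT isT => nu; have := height_not_up nu; lia.
- by lia.
Qed.

End BracketSequence.

(** * Levels and heights *)

(* The positions at which the flag has a member, 0 included. *)
Definition level (I : seq nat) (i : nat) : bool := i \in 0 :: I.

Definition tops (w : tableau) (i : nat) := count (fun x => x <= i) w.1.
Definition bots (w : tableau) (i : nat) := count (fun x => x <= i) w.2.

Section Levels.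

Variables (n : nat) (I : seq nat).
Hypothesis HI : valid_type n I.

Lemma iiE l : ii I l = nth 0 (0 :: I) l.
Proof. by case: l. Qed.

Lemma type_path : path ltn 0 I.
Proof. by have [] := HI; case: (I) => //= x s _ -> /= ->. Qed.

Lemma ii_lt l l' : l < l' -> l' <= size I -> ii I l < ii I l'.
Proof.
move=> ll' l's; rewrite !iiE.
by apply: (sorted_ltn_nth ltn_trans 0 (s := 0 :: I) type_path) => //; rewrite inE /=; lia.
Qed.

Lemma ii_lt_inv l l' : l <= size I -> l' <= size I -> ii I l < ii I l' -> l < l'.
Proof.
move=> ls l's; apply: contraTT; rewrite -!leqNgt leq_eqVlt => /orP[/eqP->//|lt].
exact: ltnW (ii_lt lt ls).
Qed.

Lemma ii_inj l l' : l <= size I -> l' <= size I -> ii I l = ii I l' -> l = l'.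
Proof.
move=> ls l's E; case: (ltngtP l l') => // lt.
  by have := ii_lt lt l's; rewrite E ltnn.
by have := ii_lt lt ls; rewrite E ltnn.
Qed.

Lemma ii_size : ii I (size I) = n.
Proof. by have [_ _ _ <-] := HI; rewrite iiE -[size I]/(size (0 :: I)).-1 nth_last. Qed.

Lemma levelP i : reflect (exists2 l, l <= size I & ii I l = i) (level I i).
Proof.
apply: (iffP (nthP 0)) => [[l ls <-]|[l ls <-]]; exists l => //; by rewrite ?iiE.
Qed.

Lemma level_ii l : l <= size I -> level I (ii I l).
Proof. by move=> ls; apply/levelP; exists l. Qed.

Lemma level_gt0P i : 0 < i -> level I i = (i \in I).
Proof. by rewrite /level inE; case: i. Qed.

Lemma type_pos : 0 \notin I.
Proof.
apply/negP => /(nthP 0)[l ls E]; have := @ii_lt 0 l.+1 isT ls.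
by rewrite /= E.
Qed.

Lemma level_le i : level I i -> i <= n.
Proof.
case/levelP=> l ls <-; rewrite -ii_size; move: ls; rewrite leq_eqVlt => /orP[/eqP->//|ls].
exact: ltnW (ii_lt ls _).
Qed.

Lemma leveln : level I n.
Proof. by rewrite -ii_size level_ii. Qed.

Lemma multE l : 0 < l <= size I -> mult I (ii I l) = ii I l - ii I l.-1.
Proof.
move=> /andP[l0 ls]; rewrite /mult (bigD1_seq l) ?iota_uniq //=; last by rewrite mem_index_iota; lia.
rewrite eqxx big1_seq ?addn0 // => l' /andP[nl]; rewrite mem_index_iota => ll'.
by case: eqP => // /ii_inj E; rewrite E ?eqxx in nl; lia.
Qed.

Lemma mult0 j : j \notin I -> mult I j = 0.
Proof.
move=> jI; rewrite /mult big1_seq // => -[|l]; rewrite mem_index_iota //= => ls.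
by case: eqP => // E; rewrite -E mem_nth in jI.
Qed.

Lemma wxP i : reflect (exists l, [/\ 0 < l <= size I, ii I l = i & ii I l - ii I l.-1 = 2]) (i \in wx I).
Proof.
apply: (iffP mapP) => [[l]|[l [ls E1 E2]]].
  by rewrite mem_filter mem_iota => /andP[/eqP E ls] ->; exists l; split=> //; lia.
by exists l => //; rewrite mem_filter mem_iota E2 eqxx /=; lia.
Qed.

End Levels.

Section Tableau.

Variables (n k : nat) (I : seq nat) (w : tableau).
Hypothesis kn : 2 * k <= n.
Hypothesis HI : valid_type n I.
Hypothesis Hw : is_rst n k I w.

Let uniq1 : uniq w.1.
Proof. by have [_ _ s1 _ _] := Hw; apply: sorted_uniq s1 => [x y z|x] /=; lia. Qed.

Let uniq2 : uniq w.2.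
Proof. by have [_ _ _ s2 _] := Hw; apply: sorted_uniq s2 => [x y z|x] /=; lia. Qed.

Lemma mem_mult j : (j \in w.1) + (j \in w.2) = mult I j.
Proof. by have [_ _ _ _ <-] := Hw; rewrite count_cat !count_uniq_mem. Qed.

(** A value occurs at most once in each strictly decreasing row, so levels advance by one or two; a
    skipped position carries the first cross of a double entry. *)
Lemma gap_le2 l : l < size I -> ii I l.+1 <= (ii I l).+2.
Proof.
move=> ls; have := mem_mult (ii I l.+1); rewrite (multE HI) //.
by rewrite [l.+1.-1]/=; case: (_ \in _); case: (_ \in _); lia.
Qed.

Lemma not_level_wx i : 0 < i <= n -> ~~ level I i -> i.+1 \in wx I.
Proof.
move=> /andP[i0 iN] ni.
have ex : exists l, i < ii I l.
  have : i < n by rewrite ltn_neqAle iN andbT; apply: contraNneq ni => ->; exact: leveln.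
  by exists (size I); rewrite (ii_size HI).
have [[|l] /= il lmin] := ex_minnP ex; first by [].
have ls : l < size I by rewrite ltnNge; apply/negP => ?; move: il; rewrite nth_default.
have li : ii I l <= i by rewrite leqNgt; apply/negP => /lmin; rewrite ltnn.
have {}li : ii I l < i.
  rewrite ltn_neqAle li andbT; apply: contraNneq ni => <-.
  by apply/levelP; exists l => //; lia.
have := gap_le2 ls; rewrite /= => ?.
by apply/wxP; exists l.+1; split => //=; lia.
Qed.

Lemma wx_level i : i \in wx I -> [/\ 1 < i, level I i, level I i.-2 & ~~ level I i.-1].
Proof.
case/wxP=> -[|l] [// ls E1]; rewrite E1 /= => E2.
split; first by lia.
- by apply/levelP; exists l.+1.
- by apply/levelP; exists l; lia.
- apply/negP => /levelP[l' ls' E].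
  have : l < l' by apply: (ii_lt_inv HI) => //; lia.
  have : l' < l.+1 by apply: (ii_lt_inv HI) => //; lia.
  by lia.
Qed.

Lemma not_wx_level i : 0 < i -> level I i -> i \notin wx I -> level I i.-1 /\ i.+1 \notin wx I.
Proof.
move=> i0 li nw; split; last first.
  by apply: contraTN li => /wx_level[].
case/levelP: li i0 nw => -[|l] ls <- // i0 nw.
apply/levelP; exists l; first by lia.
have := gap_le2 ls; have := ii_lt HI (ltnSn l) ls => ? ?.
suff : ii I l.+1 != (ii I l).+2 by lia.
by apply: contraNneq nw => E; apply/wxP; exists l.+1; split=> //=; rewrite -/(ii I l.+1); lia.
Qed.

Lemma mult_level i : 0 < i -> level I i -> mult I i = if i \in wx I then 2 else 1.
Proof.
move=> i0 li; case: (boolP (i \in wx I)) => [/wxP[l [ls <- <-]]|nw].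
  by rewrite (multE HI).
have [li1 _] := not_wx_level i0 li nw.
case/levelP: (li) => -[|l] ls E; first by move: i0; rewrite -E.
case/levelP: li1 => l' ls' E'.
have E2 : l = l'.
  have := ii_lt HI (ltnSn l) ls => ?.
  have : l' < l.+1 by apply: (ii_lt_inv HI) => //; lia.
  have : ~~ (l' < l); last by lia.
  by apply/negP => lt; have := ii_lt HI lt; lia.
by rewrite -E (multE HI) // E [l.+1.-1]/= E2 E'; lia.
Qed.

Lemma tops0 : tops w 0 = 0.
Proof.
rewrite /tops; apply/eqP; rewrite -leqn0 leqNgt -has_count; apply/hasPn => x xw.
have := mem_mult x; rewrite xw; case: x xw => // _; rewrite mult0 //.
exact: type_pos HI.
Qed.

Lemma bots0 : bots w 0 = 0.
Proof.
rewrite /bots; apply/eqP; rewrite -leqn0 leqNgt -has_count; apply/hasPn => x xw.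
have := mem_mult x; rewrite xw; case: x xw => // _; rewrite mult0 //; last exact: type_pos HI.
by case: (_ \in _).
Qed.


Let countS (s : seq nat) i : uniq s ->
  count (fun x => x <= i.+1) s = count (fun x => x <= i) s + (i.+1 \in s).
Proof.
move=> us; rewrite -count_uniq_mem //; elim: s {us} => //= x s ->.
by rewrite addnACA; congr (_ + _); lia.
Qed.

Lemma topsS i : tops w i.+1 = tops w i + (i.+1 \in w.1).
Proof. exact: countS. Qed.

Lemma botsS i : bots w i.+1 = bots w i + (i.+1 \in w.2).
Proof. exact: countS. Qed.

Lemma entry_le i x : n <= i -> (x \in w.1) || (x \in w.2) -> x <= i.
Proof.
move=> ni xw; have : x \in I.
  by apply/negPn/negP => xI; have := mem_mult x; rewrite mult0 //; move: xw; do 2 case: (_ \in _).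
by move=> xI; apply: leq_trans ni; apply: (level_le HI); rewrite /level inE xI orbT.
Qed.

Lemma topsn : tops w n = n - k.
Proof.
have [<- _ _ _ _] := Hw; apply/eqP; rewrite -all_count; apply/allP => x xw.
by apply: entry_le; rewrite ?xw.
Qed.

Lemma botsn : bots w n = k.
Proof.
have [_ <- _ _ _] := Hw; apply/eqP; rewrite -all_count; apply/allP => x xw.
by apply: entry_le; rewrite ?xw ?orbT.
Qed.

Lemma tops_le i : tops w i <= n - k.
Proof. by have [<- _ _ _ _] := Hw; apply: count_size. Qed.

Lemma bots_le i : bots w i <= k.
Proof. by have [_ <- _ _ _] := Hw; apply: count_size. Qed.

Variant level_step_spec i : Prop :=
| StepUp j of i = j.+1 & level I j & wt I w i = Up & tops w i = (tops w j).+1 & bots w i = bots w j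
| StepDn j of i = j.+1 & level I j & wt I w i = Dn & tops w i = tops w j & bots w i = (bots w j).+1
| StepCr j of i = j.+2 & level I j & ~~ level I j.+1 & wt I w i = Cr & wt I w j.+1 = Cr
    & tops w i = (tops w j).+1 & bots w i = (bots w j).+1.

Lemma level_stepP i : 0 < i -> level I i -> level_step_spec i.
Proof.
move=> i0 li; have := mem_mult i; rewrite mult_level //.
case: (boolP (i \in wx I)) => iw.
  have [i1] := wx_level iw; case: i i1 i0 li iw => [|[|j]] // _ _ _ iw _ lj nlj M.
  have := mem_mult j.+1; rewrite mult0; last by rewrite -level_gt0P.
  move=> M'; apply: (StepCr erefl lj nlj); rewrite /wt ?iw ?orbT //.
    by rewrite !topsS; move: M M'; do 4 case: (_ \in _); lia.
  by rewrite !botsS; move: M M'; do 4 case: (_ \in _); lia.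
have [lj nw] := not_wx_level i0 li iw; case: i i0 li iw lj nw => // j _ _ iw lj nw M.
case E1 : (j.+1 \in w.1) M; case E2 : (j.+1 \in w.2) => // _.
  by apply: (StepUp erefl lj); rewrite /wt ?(negbTE iw) ?(negbTE nw) /= ?topsS ?botsS ?E1 ?E2 //; lia.
by apply: (StepDn erefl lj); rewrite /wt ?(negbTE iw) ?(negbTE nw) /= ?topsS ?botsS ?E1 ?E2 //; lia.
Qed.

Lemma not_level_wt i : 0 < i <= n -> ~~ level I i ->
  [/\ wt I w i = Cr, i \in w.1 = false & i \in w.2 = false].
Proof.
move=> iN nl; rewrite /wt (not_level_wx iN nl) orbT; have := mem_mult i.
rewrite mult0; first by do 2 case: (_ \in _).
by rewrite -level_gt0P //; case/andP: iN.
Qed.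

Lemma wt_not_cr i : 0 < i <= n -> ~~ is_cr (wt I w i) -> level I i /\ level I i.-1.
Proof.
move=> iN nc; have li : level I i.
  by apply: contraNT nc => nl; have [-> _ _] := not_level_wt iN nl.
split=> //; case/andP: iN => i0 _.
by case: (level_stepP i0 li) => j E lj; [rewrite E|rewrite E|move=> _ wc; rewrite wc in nc].
Qed.

Lemma tops_bots i : level I i -> tops w i + bots w i = i.
Proof.
elim/ltn_ind: i => -[|i] IH li; first by rewrite tops0 bots0.
by case: (level_stepP _ li) => // j E lj; rewrite ?E => *; have := IH j _ lj; lia.
Qed.

Notation a := (ewt n k I w).
Notation h := (height a).

Lemma ewt_left s : s < n - k -> a s = Dn.
Proof. by rewrite /ewt => ->. Qed.

Lemma ewt_inner i : i < n -> a (n - k + i) = wt I w i.+1.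
Proof.
move=> iN; rewrite /ewt ltnNge leq_addr /=; case: ifP => [_|]; last by lia.
by congr (wt _ _ _.+1); lia.
Qed.

Lemma ewt_right s : 2 * n - k <= s -> a s = Up.
Proof. by rewrite /ewt => ?; case: ifP; [lia|case: ifP; [lia|]]. Qed.

Lemma height_left s : s <= n - k -> h s = (s%:Z)%R.
Proof.
elim: s => [|s IH] sl; first by rewrite height0.
by rewrite height_dn ?ewt_left // IH; lia.
Qed.

(** The added vees contribute n - k. A double entry raises [tops] and [bots] together, at its second
    cross, so the formula also holds between the two crosses. *)
Lemma height_inner i : i <= n -> h (n - k + i) = ((n - k)%N%:Z + (bots w i)%:Z - (tops w i)%:Z)%R.
Proof.
elim: i => [|i IH] iN; first by rewrite addn0 height_left // tops0 bots0; lia.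
rewrite addnS heightS IH 1?ltnW // ewt_inner // topsS botsS.
have [li|nl] := boolP (level I i.+1); last first.
  by have [|-> -> ->] := not_level_wt _ nl; [lia|rewrite /=; lia].
case: (level_stepP _ li) => // j [E] lj; rewrite {}E in IH iN li *.
- by move=> ->; rewrite topsS botsS /=; lia.
- by move=> ->; rewrite topsS botsS /=; lia.
move=> nlj -> _; have [|_ e1 e2] := not_level_wt _ nlj; first by lia.
by rewrite !topsS !botsS e1 e2 /=; lia.
Qed.

Lemma height_right r : r <= k -> h (2 * n - k + r) = (k%:Z - r%:Z)%R.
Proof.
elim: r => [|r IH] rk; last by rewrite addnS height_up ?ewt_right ?leq_addr // IH; lia.
have -> : 2 * n - k + 0 = n - k + n by lia.
by rewrite height_inner // topsn botsn; lia.
Qed.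

Lemma height_refl s : 2 * n - k <= s <= 2 * n -> h s = ((2 * n - s)%N%:Z)%R.
Proof.
move=> sr; have -> : s = 2 * n - k + (s - (2 * n - k)) by lia.
by rewrite height_right; lia.
Qed.

Lemma height_nonneg s : s <= 2 * n -> (0 <= h s)%R.
Proof.
move=> sN; case: (leqP s (n - k)) => [/height_left ->//|s1].
case: (leqP (2 * n - k) s) => [s2|s2]; first by rewrite height_refl; lia.
have -> : s = n - k + (s - (n - k)) by lia.
by rewrite height_inner; have := tops_le (s - (n - k)); lia.
Qed.

Lemma height_end : h (2 * n) = 0%R.
Proof. by rewrite height_refl; lia. Qed.

End Tableau.

(** * Red circles and orientations *)

Definition arch_of n k I w := arch (2 * n) (ewt n k I w).

Section Outer.

Variables (n k : nat) (I : seq nat).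
Hypothesis kn : 2 * k <= n.
Hypothesis HI : valid_type n I.

Section OneTableau.

Variable w : tableau.
Hypothesis Hw : is_rst n k I w.

Notation A := (arch_of n k I w).

Lemma cupE s t : cup n k I w s t = A s t && (inner n k s || inner n k t).
Proof. by rewrite /cup /A /arch /dep -!andbA. Qed.

Lemma usedP p : p < 2 * n ->
  reflect (exists2 t, A p t || A t p & inner n k p || inner n k t) (used n k I w p).
Proof.
move=> pN; apply: (iffP hasP) => [[t _]|[t pt io]].
  by rewrite !cupE => /orP[/andP[pt io]|/andP[pt io]]; exists t; rewrite ?pt ?orbT // orbC.
exists t; last by rewrite !cupE io [inner n k t || _]orbC io !andbT.
rewrite mem_iota /=; case/orP: pt => /archP[/andP[] *]; lia.
Qed.

Lemma ex_arch s : s < 2 * n -> ~~ is_cr (ewt n k I w s) -> exists t, A s t || A t s.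
Proof.
move=> sN nc; case E : (ewt n k I w s) nc => // _.
  have [|t st] := ex_arch_left (height_nonneg kn HI Hw) sN (_ : is_up (ewt n k I w s)); first by rewrite E.
  by exists t; rewrite /arch_of st orbT.
have [|t st] := ex_arch_right (height_nonneg kn HI Hw) (height_end kn HI Hw) sN (_ : is_dn (ewt n k I w s)).
  by rewrite E.
by exists t; rewrite /arch_of st.
Qed.

(** Heights on the added points are the distances to the two ends of the sequence, and an arch joins
    equal heights, so its ends are mirror images. *)
Lemma arch_outer s t : A s t -> ~~ inner n k s -> ~~ inner n k t -> s < k /\ t = 2 * n - s.+1.
Proof.
case/archP=> /andP[st tN] ds ut E _; rewrite /inner => si ti.
have sl : s < n - k.
  by rewrite ltnNge; apply/negP => ls; move: ds; rewrite ewt_right //; lia.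
have tl : 2 * n - k <= t.
  rewrite leqNgt; apply/negP => lt; move: ut; rewrite ewt_left //; lia.
by move: E; rewrite (height_left kn Hw (ltnW sl)) (height_refl kn HI Hw); lia.
Qed.

Lemma unused_left p : p < n - k -> ~~ used n k I w p = (p < k) && A p (2 * n - p.+1).
Proof.
move=> pl; have pN : p < 2 * n by lia.
have pi : ~~ inner n k p by rewrite /inner; lia.
apply/idP/andP => [nu|[pk pq]].
  have [|t pt] := ex_arch pN; first by rewrite ewt_left.
  have ti : ~~ inner n k t.
    by apply: contra nu => ti; apply/usedP=> //; exists t; rewrite // ti orbT.
  case/orP: pt => pt; first by have [pk E] := arch_outer pt pi ti; rewrite -E.
  by case/archP: pt => _ _; rewrite ewt_left.
apply/negP => /usedP[//|t pt]; rewrite (negbTE pi) /= => ti.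
have ? : t = 2 * n - p.+1.
  case/orP: pt => pt; first by apply: arch_right_uniq pt pq.
  by rewrite /arch_of (arch_asym _ pt) in pq.
by subst t; move: ti; rewrite /inner; lia.
Qed.

Lemma unused_right p : p < k -> ~~ used n k I w (2 * n - p.+1) = A p (2 * n - p.+1).
Proof.
move=> pk; set q := 2 * n - p.+1; have qN : q < 2 * n by lia.
have qi : ~~ inner n k q by rewrite /inner; lia.
apply/idP/idP => [nu|pq].
  have [|t pt] := ex_arch qN; first by rewrite ewt_right // /q; lia.
  have ti : ~~ inner n k t.
    by apply: contra nu => ti; apply/usedP=> //; exists t; rewrite // ti orbT.
  case/orP: pt => pt; first by case/archP: pt => _; rewrite ewt_right // /q; lia.
  have [tk E] := arch_outer pt ti qi; have -> // : p = t by move: E; rewrite /q; lia.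
apply/negP => /usedP[//|t pt]; rewrite (negbTE qi) /= => ti.
have ? : t = p.
  case/orP: pt => pt; last by apply: arch_left_uniq pt pq.
  by rewrite /arch_of (arch_asym _ pq) in pt.
by subst t; move: ti; rewrite /inner; lia.
Qed.

Lemma used_refl p : p < k -> used n k I w (2 * n - p.+1) = used n k I w p.
Proof. by move=> pk; apply: negb_inj; rewrite unused_right // unused_left ?pk //; lia. Qed.

End OneTableau.

Section TwoTableaux.

Variables x y : tableau.
Hypothesis Hx : is_rst n k I x.
Hypothesis Hy : is_rst n k I y.

Notation E := (extra n k I x y).
Notation A := (arch_of n k I x).

Let extra_refl p : p < k -> E (2 * n - p.+1) = E p.
Proof. by move=> pk; rewrite /extra !used_refl. Qed.

Let extra_lt p : p < n - k -> E p -> p < k.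
Proof. by move=> pl /andP[_]; rewrite unused_left // => /andP[]. Qed.

Let c p := count E (iota p.+1 (k - p.+1)).

Let c_left p : p < k -> count E (iota p.+1 (n - k - p.+1)) = c p.
Proof.
move=> pk; have -> : n - k - p.+1 = (k - p.+1) + (n - 2 * k) by lia.
rewrite iotaD count_cat -/(c p) -[RHS]addn0; congr (_ + _).
apply/eqP; rewrite -leqn0 leqNgt -has_count; apply/hasPn => r; rewrite mem_iota => rI.
by apply: contraTN rI => /extra_lt; lia.
Qed.

Let c_right p : p < k -> count E (iota (2 * n - k) (2 * n - p.+1 - (2 * n - k))) = c p.
Proof.
move=> pk; rewrite /c.
have -> : count E (iota p.+1 (k - p.+1)) =
          count E [seq 2 * n - r.+1 | r <- iota p.+1 (k - p.+1)].
  by rewrite count_map; apply: eq_in_count => r; rewrite mem_iota /= => rI; rewrite extra_refl; lia.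
apply/permP: E; apply: uniq_perm; first exact: iota_uniq.
  by rewrite map_inj_in_uniq ?iota_uniq // => a b; rewrite !mem_iota; lia.
move=> r; rewrite mem_iota; apply/idP/mapP => [rI|[s]]; last by rewrite mem_iota; lia.
by exists (2 * n - r.+1); rewrite ?mem_iota; lia.
Qed.

Let c_decr p p' : p < p' < k -> E p' -> c p' < c p.
Proof.
move=> pp Ep'; rewrite /c.
have -> : k - p.+1 = (p' - p.+1) + (k - p'.+1).+1 by lia.
rewrite iotaD count_cat /= (_ : p.+1 + _ = p') ?Ep'; lia.
Qed.

(** Being extra is invariant under the reflection of the added points, so the j-th extra point from
    the inside on the left is the mirror image of the j-th on the right. The count [c] is strictly
    monotone on extra points and therefore identifies them. *)
Lemma xarcP p q : q < 2 * n ->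
  reflect [/\ p < k, q = 2 * n - p.+1 & E p] (xarc n k I x y p q).
Proof.
move=> qN; apply: (iffP and5P) => [[pl /andP[qr _] Ep Eq /eqP C]|[pk qE Ep]].
  have pk := extra_lt pl Ep; split=> //.
  have [p' p'k qp] : exists2 p', p' < k & q = 2 * n - p'.+1.
    by exists (2 * n - q.+1); lia.
  move: C Eq; rewrite qp c_left // c_right // extra_refl // => C Ep'.
  case: (ltngtP p p') => [lt|lt|-> //].
    by have := @c_decr p p'; rewrite lt p'k C ltnn => /(_ isT Ep').
  by have := @c_decr p' p; rewrite lt pk C ltnn => /(_ isT Ep).
rewrite /louter /router Ep qE extra_refl // c_left // c_right //; split=> //; lia.
Qed.

(** A green arc replacing missing points of [x] is an arch of [x] between two added points, kept
    because [y] uses them. So the arcs on one side are all arches of that tableau that touch a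
    present point. *)
Lemma arcE p q : p < 2 * n -> q < 2 * n ->
  Defs.arc n k I x y p q = (A p q || A q p) && (used n k I x p || used n k I y p).
Proof.
move=> pN qN; apply/idP/andP => [/or4P[]|].
- rewrite cupE => /andP[pq io]; split; first by rewrite pq.
  by apply/orP; left; apply/usedP => //; exists q => //; rewrite pq.
- rewrite cupE => /andP[qp io]; split; first by rewrite qp orbT.
  by apply/orP; left; apply/usedP => //; exists q; rewrite ?qp ?orbT // orbC.
- case/xarcP=> // pk qE /andP[uy ux]; rewrite uy orbT; split=> //.
  by move: ux; rewrite unused_left //; [case/andP; rewrite qE => _ ->|lia].
- case/xarcP=> // qk pE Eq; move: (Eq) => /andP[uy ux]; split.
    by move: ux; rewrite unused_left //; [case/andP; rewrite pE => _ ->; rewrite orbT|lia].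
  have : E p by rewrite pE extra_refl.
  by case/andP=> ->; rewrite orbT.
case=> pq pres; rewrite /Defs.arc !cupE.
have [io|] := boolP (inner n k p || inner n k q).
  by case/orP: pq => ->; rewrite ?io // [inner n k q || _]orbC io /= ?orbT.
rewrite negb_or => /andP[pi qi]; case/orP: pq => pq.
  have [pk qE] := arch_outer Hx pq pi qi.
  have pu : ~~ used n k I x p by rewrite unused_left ?pk -?qE //; lia.
  apply/or4P; constructor 3; apply/xarcP => //; split=> //.
  by rewrite /extra pu andbT; move: pres; rewrite (negbTE pu).
have [qk pE] := arch_outer Hx pq qi pi.
have pu : ~~ used n k I x q by rewrite unused_left ?qk -?pE //; lia.
apply/or4P; constructor 4; apply/xarcP => //; split=> //.
have : ~~ used n k I x p by rewrite pE used_refl.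
rewrite /extra pu andbT => nu; move: pres; rewrite (negbTE nu) pE used_refl //.
Qed.

Lemma arcC p q : Defs.arc n k I x y p q = Defs.arc n k I x y q p.
Proof. by rewrite /Defs.arc orbCA; congr (_ || (_ || _)); rewrite orbC. Qed.

End TwoTableaux.

(* [v s] means that the point [s] is labelled by a vee; the arches contain, besides the
   cups of eC(w), the nested arcs joining the outer points not used by them. *)
Definition orients w (v : pred nat) := forall s t, arch_of n k I w s t -> v s != v t.
Definition outer_standard (v : pred nat) :=
  (forall s, s < n - k -> v s) /\ (forall s, 2 * n - k <= s < 2 * n -> ~~ v s).

Section Red.

Variables w w' : tableau.
Hypothesis Hw : is_rst n k I w.
Hypothesis Hw' : is_rst n k I w'.

Notation pres := (fun p => used n k I w p || used n k I w' p).
Let M x : rel 'I_(2 * n) := fun p q => arch_of n k I x p q || arch_of n k I x q p.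

(** Crosses depend on the type alone; hence a point used by one tableau carries an arch of the other
    as well. *)
Let ewt_cr x y p : is_cr (ewt n k I x p) = is_cr (ewt n k I y p).
Proof. by rewrite /ewt /wt; case: ifP => // _; case: ifP => // _; case: ifP => // _; do 2 case: ifP. Qed.

Let used_not_cr x p : p < 2 * n -> used n k I x p -> ~~ is_cr (ewt n k I x p).
Proof.
move=> pN /(usedP x pN)[t /orP[]/archP[_ d u _ _] _].
  by move: d; case: (ewt _ _ _ _ p).
by move: u; case: (ewt _ _ _ _ p).
Qed.

Let M_arch_lt x (p q : 'I_(2 * n)) : M x p q -> p < q -> arch_of n k I x p q.
Proof. by case/orP=> // /archP[/andP[qp _] _ _ _ _]; lia. Qed.

Let matchingM x y : is_rst n k I x -> is_rst n k I y ->
  noncrossing_matching (fun p => used n k I x p || used n k I y p) (M x).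
Proof.
move=> Hx Hy; split.
- by move=> p q; rewrite /M orbC.
- by move=> p; rewrite /M orbb; apply/negP => /archP[/andP[]]; lia.
- move=> p q r /orP[] pq /orP[] pr; apply: val_inj.
  + exact: arch_right_uniq pq pr.
  + by move: pq; rewrite /arch_of (arch_asym _ pr).
  + by move: pr; rewrite /arch_of (arch_asym _ pq).
  + exact: arch_left_uniq pq pr.
- move=> p q pq pp; have : Defs.arc n k I x y p q by rewrite arcE // pp andbT.
  by rewrite arcC arcE // => /andP[].
split=> [p pp|p q r t pq rt pr rq].
  have [|t] := @ex_arch x Hx p (ltn_ord p).
    by case/orP: pp => /used_not_cr; [|rewrite (ewt_cr x y)]; apply.
  move=> pt; have tN : t < 2 * n by case/orP: pt => /archP[/andP[]]; lia.
  by exists (Ordinal tN).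
have {}pq := M_arch_lt pq (ltn_trans pr rq).
case/orP: rt => rt.
  have := arch_noncrossing pq rt; case/archP: rt => /andP[]; lia.
have := arch_noncrossing_left pq rt; case/archP: rt => /andP[]; lia.
Qed.

Let ccrelE p q : ccrel n k I w w' p q = pres p && (M w p q || M w' p q).
Proof. by rewrite /ccrel !arcE // (orbC (used n k I w' p)) -andb_orl andbC. Qed.

Let presentE (p : 'I_(2 * n)) : present n k I w w' p = pres p.
Proof.
rewrite /present; apply/orP/idP => [[/andP[pi nc]|//]|]; last by right.
have [t pt] := ex_arch Hw (ltn_ord p) nc.
by apply/orP; left; apply/usedP => //; exists t; rewrite ?pi.
Qed.

Lemma red_circleP :
  has_red_circle n k I w w' <->
  ~ exists v, [/\ outer_standard v, orients w v & orients w' v].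
Proof.
have lo_down (p q : 'I_(2 * n)) : p <= q -> louter n k q -> louter n k p.
  by rewrite /louter; lia.
have ro_up (p q : 'I_(2 * n)) : p <= q -> router n k p -> router n k q.
  by rewrite /router; have := ltn_ord q; lia.
have mw := matchingM Hw Hw'.
have mw' : noncrossing_matching pres (M w').
  have [a b c d [e f]] := matchingM Hw' Hw; split=> //; last split=> // p pp.
    by move=> p q pq pp; rewrite orbC; apply: d pq _; rewrite orbC.
  by apply: e; rewrite orbC.
have CP := no_red_circleP lo_down ro_up mw mw'.
set e := (X in connect X) in CP.
have conE p q : connect (ccrel n k I w w') p q = connect e p q.
  by apply: eq_connect => {}p {}q; rewrite ccrelE.
have cardE p (P : pred 'I_(2 * n)) :
    #|[pred q | connect (ccrel n k I w w') p q && P q]| = #|[pred q | connect e p q && P q]|.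
  by apply: eq_card => q; rewrite !inE conE.
split.
- case=> p [pp red] [v [[vl vr] vw vw']].
  rewrite presentE in pp.
  have [|c1 c2] := CP.1 _ p pp; last by move: red; rewrite !cardE; case; lia.
  exists (fun p : 'I_(2 * n) => v p); split=> [q r|q _|q _]; last 2 first.
  + exact: vl.
  + by case/andP=> ? ?; apply: vr; apply/andP.
  case/andP=> _ /orP[]/orP[]; [exact: vw| |exact: vw'|];
    by rewrite eq_sym; (exact: vw || exact: vw').
- move=> nv.
  (* Over a finite type the existence of a red circle is decidable, so its absence can be used
     without classical logic. *)
  pose red := [exists p : 'I_(2 * n), present n k I w w' p &&
    ((1 < #|[pred q : 'I_(2 * n) | connect (ccrel n k I w w') p q && louter n k q]|)
     || (1 < #|[pred q : 'I_(2 * n) | connect (ccrel n k I w w') p q && router n k q]|))].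
  have [/existsP[p /andP[pp /orP r]]|/existsPn nred] := boolP red; first by exists p; split.
  case: nv; have [|l [l_alt l_lo l_ro]] := CP.2.
    move=> p pp; have := nred p; rewrite presentE pp /= !cardE negb_or -!leqNgt.
    by case/andP.
  (* Outer points absent from both diagrams get the standard labels, so the arches joining two of
     them alternate too; on present outer points this agrees with l. *)
  pose v s := if s < n - k then true else if 2 * n - k <= s then false else
    if insub s is Some p then l p else true.
  have vl (p : 'I_(2 * n)) : pres p -> v p = l p.
    move=> pp; rewrite /v; case: ifP => [pl|_]; first by rewrite (l_lo p).
    case: ifP => [pr|_]; last by rewrite valK.
    by rewrite (negbTE (l_ro p _ _)) //; rewrite /router pr /=.
  have vor x y : is_rst n k I x -> (forall p, pres p = (used n k I x p || used n k I y p)) ->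
      is_rst n k I y -> (forall p q : 'I_(2 * n), pres p -> M x p q -> e p q) -> orients x v.
    move=> Hx Ep Hy xe s t st.
    have /archP[/andP[lst tN] _ _ _ _] := st; have sN := ltn_trans lst tN.
    pose s' := Ordinal sN; pose t' := Ordinal tN.
    have [ps|nps] := boolP (pres s').
      have Mst : M x s' t' by rewrite /M st.
      have [_ _ _ Mp _] := matchingM Hx Hy.
      rewrite -[s]/(val s') -[t]/(val t') !vl //; first by apply: l_alt; apply: xe.
      by rewrite Ep; apply: Mp Mst _; rewrite -Ep.
    have /negP ni : ~~ (inner n k s || inner n k t).
      apply: contra nps => io; rewrite Ep; apply/orP; left; apply/usedP => //.
      by exists t; rewrite ?st.
    have si : ~~ inner n k s by apply/negP => h; case: ni; rewrite h.
    have ti : ~~ inner n k t by apply/negP => h; case: ni; rewrite h orbT.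
    have [sk tE] := arch_outer Hx st si ti.
    have [sl tr] : s < n - k /\ 2 * n - k <= t by lia.
    have tl : (t < n - k) = false by lia.
    by rewrite /v sl tl tr.
  exists v; split.
  + by split=> s sr; rewrite /v ?sr //; case: ifP; [lia|case: ifP => //; lia].
  + by apply: (vor w w') => // p q pp pq; rewrite /e pp pq.
  + apply: (vor w' w) => // [p|p q pp pq]; first by rewrite orbC.
    by rewrite /e pp pq orbT.
Qed.

End Red.
End Outer.

(** * Chains of cups *)

(* [a] and [b] are the numbers of points of 1..n to the left of the two endpoints:
   this is the cup (a+1, b+1) of the paper. *)
Definition black_cup n k I w a b := (b < n) && arch_of n k I w (n - k + a) (n - k + b).

Section Chains.

Variables (n k : nat) (I : seq nat) (w : tableau).
Hypothesis kn : 2 * k <= n.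
Hypothesis HI : valid_type n I.
Hypothesis Hw : is_rst n k I w.

Notation cupb := (black_cup n k I w).
Notation a_ := (ewt n k I w).
Notation bots := (bots w).
Notation tops := (tops w).

Variant next_level_spec a : Prop :=
| NextUp of level I a.+1 & a_ (n - k + a) = Up & tops a.+1 = (tops a).+1 & bots a.+1 = bots a
| NextDn of level I a.+1 & a_ (n - k + a) = Dn & tops a.+1 = tops a & bots a.+1 = (bots a).+1
| NextCr of level I a.+2 & ~~ level I a.+1 & tops a.+2 = (tops a).+1 & bots a.+2 = (bots a).+1.

Lemma next_levelP a : level I a -> a < n -> next_level_spec a.
Proof.
move=> la an; have [la1|nla1] := boolP (level I a.+1).
  have E := ewt_inner kn Hw an.
  by case: (level_stepP kn HI Hw _ la1) => // j [<-] => [lj|lj|lja /negP//] Ea *;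
     [apply: NextUp|apply: NextDn]; rewrite // E.
have [|_ la2 _ _] := wx_level kn HI Hw (not_level_wx kn HI Hw _ nla1); first by rewrite an.
case: (level_stepP kn HI Hw _ la2) => // j [<-] *; first by case/negP: nla1.
  by case/negP: nla1.
exact: NextCr.
Qed.

(** Indexed by the level itself, so that a case analysis rewrites the level everywhere instead of
    leaving an equation. *)
Variant prev_level_spec : nat -> Prop :=
| PrevUp a of level I a & a_ (n - k + a) = Up & tops a.+1 = (tops a).+1 & bots a.+1 = bots a :
    prev_level_spec a.+1
| PrevDn a of level I a & a_ (n - k + a) = Dn & tops a.+1 = tops a & bots a.+1 = (bots a).+1 :
    prev_level_spec a.+1
| PrevCr a of level I a & ~~ level I a.+1 & tops a.+2 = (tops a).+1 & bots a.+2 = (bots a).+1 :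
    prev_level_spec a.+2.

Lemma prev_levelP b : 0 < b -> level I b -> prev_level_spec b.
Proof.
move=> b0 lb; have bn := level_le HI lb; case: (level_stepP kn HI Hw b0 lb) => j E; subst b.
- by move=> lj Ea *; apply: PrevUp; rewrite // ewt_inner.
- by move=> lj Ea *; apply: PrevDn; rewrite // ewt_inner.
- by move=> *; apply: PrevCr.
Qed.

Lemma level_of_ewt m : m < n -> ~~ is_cr (a_ (n - k + m)) -> level I m /\ level I m.+1.
Proof.
by move=> mn; rewrite ewt_inner // => /(wt_not_cr kn HI Hw)[]; rewrite ?mn.
Qed.

Lemma black_cupP a b : cupb a b ->
  [/\ a < b < n, [/\ level I a, level I a.+1, level I b & level I b.+1],
      (bots a.+1 = (bots a).+1 /\ tops a.+1 = tops a),
      (bots b.+1 = bots b /\ tops b.+1 = (tops b).+1)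
    & tops b.+1 + bots a = bots b.+1 + tops a].
Proof.
case/andP=> bn /archP[/andP[ab _] da ub E _].
have an : a < n by lia.
have [la la1] : level I a /\ level I a.+1 by apply: level_of_ewt => //; case: (a_ _) da.
have [lb lb1] : level I b /\ level I b.+1 by apply: level_of_ewt => //; case: (a_ _) ub.
split; [lia|by split| | |].
- by case: (next_levelP la an) => [_ e|_ _ -> ->|_ /negP//]; first by rewrite e in da.
- by case: (next_levelP lb bn) => [_ _ -> ->|_ e|_ /negP//]; last by rewrite e in ub.
by move: E; rewrite -addnS !(height_inner kn HI Hw); lia.
Qed.

(** The exponent attached to a cup is half the number of points, crosses included, from one end to
    the other. *)
Lemma black_cup_size a b : cupb a b -> b.+1 = a + 2 * (bots b.+1 - bots a) /\ bots a <= bots b.+1.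
Proof.
case/black_cupP=> /andP[ab bn] [la _ _ lb] _ _ E.
by have := tops_bots kn HI Hw la; have := tops_bots kn HI Hw lb; lia.
Qed.

(** The left end of the nested arch exceeds s, so the bound on s makes it one of the points 1..n and
    the cup black. *)
Lemma nested_up s t m : arch_of n k I w s t -> n - k <= s.+1 -> s < n - k + m < t -> m < n ->
  a_ (n - k + m) = Up -> exists2 c, s < n - k + c & cupb c m.
Proof.
move=> st sl mst mn um.
have mN : n - k + m < 2 * n by lia.
have [|r rm] := ex_arch_left (height_nonneg kn HI Hw) mN; first by rewrite um.
have sr := arch_noncrossing_left st rm mst.
exists (r - (n - k)); first by lia.
by rewrite /black_cup mn /arch_of; rewrite (_ : n - k + (r - _) = r) //; lia.
Qed.

Lemma nested_dn s t m : arch_of n k I w s t -> t <= 2 * n - k -> s < n - k + m < t -> 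
  a_ (n - k + m) = Dn -> exists2 d, n - k + d < t & cupb m d.
Proof.
move=> st tr mst dm.
have mN : n - k + m < 2 * n by case/archP: st => /andP[]; lia.
have [|r mr] := ex_arch_right (height_nonneg kn HI Hw) (height_end kn HI Hw) mN; first by rewrite dm.
have rt := arch_noncrossing st mr mst.
have mr' : n - k + m < r by case/archP: mr => /andP[].
exists (r - (n - k)); first by lia.
by rewrite /black_cup /arch_of; rewrite (_ : n - k + (r - _) = r); [rewrite mr andbT|]; lia.
Qed.

Section Relation.

(** To be read as N^q F_b <= F_a. The instances are [drops g], the inclusion itself, and
    [slow beta], its numerical trace. *)
Variable K : nat -> nat -> nat -> Prop.
Hypothesis K0 : forall a, level I a -> K a a 0.
Hypothesis KD : forall a b c q q', level I a -> level I b -> level I c ->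
  K a b q -> K b c q' -> K a c (q + q').
Hypothesis K1 : forall a, level I a -> level I a.+1 -> K a a.+1 1.
Hypothesis K2 : forall a, level I a -> ~~ level I a.+1 -> level I a.+2 -> K a a.+2 1.

(** Walk down from b to a: a wedge is jumped over along its cup, while a vee or a double entry costs
    one power of N. The total exponent is the growth of [bots]. *)
Lemma chain_bots a b : level I a -> level I b -> a <= b ->
  (forall m, a <= m < b -> a_ (n - k + m) = Up ->
     exists c, [/\ a <= c, cupb c m & K c m.+1 (bots m.+1 - bots c)]) ->
  bots a <= bots b /\ K a b (bots b - bots a).
Proof.
move=> la; elim/ltn_ind: b => b IH lb ab H.
have := ab; rewrite leq_eqVlt => /orP[/eqP E|ltab].
  by rewrite -E subnn; split=> //; apply: K0.
have IH' c : level I c -> a <= c < b -> bots a <= bots c /\ K a c (bots c - bots a).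
  move=> lc /andP[ac cb]; apply: IH => // m /andP[am mc]; apply: H.
  by rewrite am (ltn_trans mc).
have b0 : 0 < b by lia.
have P := prev_levelP b0 lb; move: lb ab ltab H IH'; clear b0 IH.
case: P => {}b lb' Eb Et Ebo lb ab ltab H IH'.
- have [||c [ac cb Kc]] := H b; [lia|by []|].
  have [/andP[cb' _] [lc _ _ _] _ _ _] := black_cupP cb; have [_ le] := black_cup_size cb.
  have [|le' Ka] := IH' c lc; first by lia.
  split; first by lia.
  by rewrite (_ : _ - _ = (bots c - bots a) + (bots b.+1 - bots c)); [apply: KD Kc|lia].
- have [|le' Ka] := IH' b lb'; first by lia.
  split; first by lia.
  by rewrite (_ : _ - _ = (bots b - bots a) + 1); [apply: KD Ka (K1 _ _)|lia].
- have ab' : a <= b.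
    by rewrite leqNgt; apply/negP => ba; case/negP: Eb; have <- : a = b.+1 by lia.
  have [|le' Ka] := IH' b lb'; first by lia.
  split; first by lia.
  by rewrite (_ : _ - _ = (bots b - bots a) + 1); [apply: KD Ka (K2 _ _ _)|lia].
Qed.

(** The mirror walk, upwards from a: vees are jumped over along their cups, wedges and double
    entries cost one each. *)
Lemma chain_tops a b : level I a -> level I b -> a <= b ->
  (forall m, a <= m < b -> a_ (n - k + m) = Dn ->
     exists d, [/\ d < b, cupb m d & K m d.+1 (tops d.+1 - tops m)]) ->
  tops a <= tops b /\ K a b (tops b - tops a).
Proof.
have [l] := ubnP (b - a); elim: l a => // l IH a lbal la lb ab H.
have := ab; rewrite leq_eqVlt => /orP[/eqP E|ltab].
  by rewrite -E subnn; split=> //; apply: K0.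
have an : a < n := leq_trans ltab (level_le HI lb).
have IH' c : level I c -> a < c <= b -> tops c <= tops b /\ K c b (tops b - tops c).
  move=> lc /andP[ac cb]; apply: IH => //; first by lia.
  by move=> m /andP[cm mb]; apply: H; rewrite mb andbT; lia.
case: (next_levelP la an) => la1 Ea Et Eb.
- have [|le Kb] := IH' a.+1 la1; first by lia.
  split; first by lia.
  by rewrite (_ : _ - _ = 1 + (tops b - tops a.+1)); [apply: KD (K1 _ _) Kb|lia].
- have [||d [db ad Kd]] := H a; [lia|by []|].
  have [/andP[ad' _] [_ _ _ ld] _ _ E] := black_cupP ad; have [_ le] := black_cup_size ad.
  have [|le' Kb] := IH' d.+1 ld; first by lia.
  split; first by lia.
  by rewrite (_ : _ - _ = (tops d.+1 - tops a) + (tops b - tops d.+1)); [apply: KD Kd Kb|lia].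
- have a2b : a.+1 < b.
    by rewrite ltn_neqAle ltab andbT; apply: contraNneq Ea => ->.
  have [|le Kb] := IH' a.+2 la1; first by lia.
  split; first by lia.
  by rewrite (_ : _ - _ = 1 + (tops b - tops a.+2)); [apply: KD (K2 _ _ _) Kb|lia].
Qed.

Lemma chain_inside a b : cupb a b ->
  (forall c d, a < c -> d < b -> cupb c d -> K c d.+1 (bots d.+1 - bots c)) ->
  bots a.+1 <= bots b /\ K a.+1 b (bots b - bots a.+1).
Proof.
move=> ab H; have [/andP[ltab bn] [_ la lb _] _ _ _] := black_cupP ab.
apply: chain_bots => // m /andP[am mb] um.
have [_ st] := andP ab; have [|||c sc cm] := nested_up st _ _ _ um; [lia|lia|lia|].
by exists c; split=> //; [lia|apply: H => //; lia].
Qed.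

Hypothesis Kcup : forall a b, cupb a b -> K a.+1 b (bots b - bots a.+1) ->
  K a b.+1 (bots b.+1 - bots a).

Lemma cup_induction a b : cupb a b -> K a b.+1 (bots b.+1 - bots a).
Proof.
have [l] := ubnP (b - a); elim: l a b => // l IH a b lbal ab.
apply: Kcup => //; have [/andP[ltab bn] _ _ _ _] := black_cupP ab.
by apply: (proj2 (chain_inside ab _)) => c d ac db cd; apply: IH => //; lia.
Qed.

End Relation.

(* With beta i = dim (rho F_i), both beta and i - beta i = dim (F_i cap P) grow by
   at most [q] from [a] to [b], as they do when N^q F_b <= F_a. *)
Definition slow (beta : nat -> nat) a b q :=
  beta b <= beta a + q /\ b + beta a <= a + beta b + q.

(* What is left of the closure of the cell of [w] when a flag is only known through
   [beta i = dim (rho F_i)]. *)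
Record admissible (beta : nat -> nat) : Prop := Admissible {
  adm0 : beta 0 = 0;
  admn : beta n = k;
  adm_step1 : forall a, level I a -> level I a.+1 -> slow beta a a.+1 1;
  adm_step2 : forall a, level I a -> ~~ level I a.+1 -> level I a.+2 -> slow beta a a.+2 1;
  adm_cup : forall a b, cupb a b -> slow beta a b.+1 (bots b.+1 - bots a);
  adm_le : forall a, level I a -> beta a <= bots a }.

Lemma slow0 beta a : slow beta a a 0.
Proof. by rewrite /slow !addn0. Qed.

Lemma slowD beta a b c q q' : slow beta a b q -> slow beta b c q' -> slow beta a c (q + q').
Proof. by rewrite /slow; lia. Qed.

Definition beta_orientation (beta : nat -> nat) (s : nat) : bool :=
  if s < n - k then true else if 2 * n - k <= s then false
  else beta (s - (n - k)).+1 != beta (s - (n - k)).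

Section AdmissibleOrients.

Variable beta : nat -> nat.
Hypothesis adm : admissible beta.

Let K := slow beta.
Let Kc0 a (_ : level I a) := slow0 beta a.
Let KcD a b c q q' (_ : level I a) (_ : level I b) (_ : level I c) := @slowD beta a b c q q'.

(** No vee before b is left open, so the walk from 0 to b costs only [tops b]; the second half of
    [slow] then says b - beta b <= tops b. This serves wedges joined to a left outer point. *)
Lemma admissible_tops_bound b : level I b ->
  (forall m, m < b -> a_ (n - k + m) = Dn -> exists2 d, d < b & cupb m d) -> bots b <= beta b.
Proof.
move=> lb H; have [//|//|//||_ [_]] := @chain_tops K Kc0 KcD (adm_step1 adm) (adm_step2 adm) 0 b.
  move=> m mb dm; have [d db md] := H m mb dm; exists d; split=> //.
  have [_ _ _ _ E] := black_cupP md; have := adm_cup adm md.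
  by rewrite (_ : tops d.+1 - tops m = bots d.+1 - bots m) //; lia.
rewrite (adm0 adm) (tops0 kn HI Hw) subn0; have := tops_bots kn HI Hw lb; lia.
Qed.

(** From a to n beta grows by at most k - [bots a], and it has to reach k. This serves vees joined
    to a right outer point. *)
Lemma admissible_bots_bound a : level I a ->
  (forall m, a <= m < n -> a_ (n - k + m) = Up -> exists2 c, a <= c & cupb c m) -> bots a <= beta a.
Proof.
move=> la H; have an := level_le HI la.
have [//||//||le [+ _]] := @chain_bots K Kc0 KcD (adm_step1 adm) (adm_step2 adm) a n.
- exact: leveln HI.
- move=> m mb dm; have [d db md] := H m mb dm; exists d; split=> //; exact: (adm_cup adm md).
by rewrite (admn adm) (botsn kn HI Hw); move: le; rewrite (botsn kn HI Hw); lia.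
Qed.

(** The cup spans 2c steps and its inside 2(c-1). The two inequalities of [slow] with exponents c
    and c-1 are then equalities: beta grows by c over the cup and by c-1 inside, so by one at the
    two ends together. *)
Lemma admissible_cup_sum a b : cupb a b ->
  beta b.+1 + beta a.+1 = (beta b + beta a).+1.
Proof.
move=> ab; have [/andP[ltab bn] [la la1 lb lb1] [Ea _] [Eb _] E] := black_cupP ab.
have [Es le] := black_cup_size ab.
have [//|le' [i1 i2]] := @chain_inside K Kc0 KcD (adm_step1 adm) (adm_step2 adm) a b ab.
  by move=> c d _ _; exact: (adm_cup adm).
have [o1 o2] := adm_cup adm ab.
rewrite /K /slow in i1 i2 o1 o2; lia.
Qed.

(** An arch with one added end has a single end inside; there beta is squeezed between [bots] from
    above and one of the two bounds from below, which decides whether it grows. *)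
Lemma admissible_orients : orients n k I w (beta_orientation beta).
Proof.
move=> s t st; rewrite /beta_orientation.
have /archP[/andP[lst tN] ds ut Eh Hh] := st.
have [sl|sl] := ltnP s (n - k).
  have [tl|tl] := ltnP t (n - k); first by move: ut; rewrite ewt_left.
  have [//|tr] := leqP (2 * n - k) t.
  pose b := t - (n - k); have tE : t = n - k + b by lia.
  have bn : b < n by lia.
  rewrite -/b; rewrite tE in st ut tr.
  have [lb lb1] : level I b /\ level I b.+1 by apply: level_of_ewt => //; case: (a_ _) ut.
  have [e1 e2] : tops b.+1 = (tops b).+1 /\ bots b.+1 = bots b.
    by case: (next_levelP lb bn) => [_ _ -> ->|_ e|_ /negP//]; last by rewrite e in ut.
  have : bots b <= beta b.
    apply: admissible_tops_bound => // m mb dm.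
    have [||d db md] := nested_dn st _ _ dm; [lia|lia|].
    by exists d => //; lia.
  by have := adm_le adm lb1; have [s1 s2] := adm_step1 adm lb lb1; move: s2; lia.
have sr : (2 * n - k <= s) = false by apply/negP => h; move: ds; rewrite ewt_right.
have tl : (t < n - k) = false by lia.
rewrite sr tl; pose a := s - (n - k); have sE : s = n - k + a by lia.
have an : a < n by lia.
rewrite -/a; rewrite sE in st ds lst.
have [la la1] : level I a /\ level I a.+1 by apply: level_of_ewt => //; case: (a_ _) ds.
have [s1 s2] := adm_step1 adm la la1.
have [tr|tr] := leqP (2 * n - k) t.
  have [e1 e2] : tops a.+1 = tops a /\ bots a.+1 = (bots a).+1.
    by case: (next_levelP la an) => [_ e|_ _ -> ->|_ /negP//]; first by rewrite e in ds.
  have : bots a.+1 <= beta a.+1.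
    apply: admissible_bots_bound => // m mb um.
    have [|||c sc cm] := nested_up st _ _ _ um; [lia|lia|lia|].
    by exists c => //; lia.
  by have := adm_le adm la; lia.
pose b := t - (n - k); have tE : t = n - k + b by lia.
have bn : b < n by lia.
have ab : cupb a b by rewrite /black_cup bn -tE.
have [_ [_ _ lb lb1] _ _ _] := black_cupP ab.
have := admissible_cup_sum ab; have [s3 s4] := adm_step1 adm lb lb1.
rewrite -/b; lia.
Qed.

End AdmissibleOrients.

(** A double entry counts once, at its second cross; the factor [level] discards the first cross,
    whose label under v is arbitrary. *)
Definition orientation_beta (v : pred nat) (i : nat) : nat :=
  \sum_(0 <= j < i) (level I j.+1 * ((j.+1 \in wx I) || v (n - k + j))).

Section OrientsAdmissible.

Variable v : pred nat.
Hypothesis v_std : outer_standard n k v.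
Hypothesis v_or : orients n k I w v.

Notation beta := (orientation_beta v).

Let betaS i : beta i.+1 = beta i + level I i.+1 * ((i.+1 \in wx I) || v (n - k + i)).
Proof. by rewrite /beta big_nat_recr. Qed.

Let beta1 a : level I a -> level I a.+1 -> beta a.+1 = beta a + v (n - k + a).
Proof.
move=> la la1; rewrite betaS la1 mul1n; case: (boolP (a.+1 \in wx I)) => //.
by case/(wx_level kn HI Hw) => _ _ _; rewrite la.
Qed.

Let beta2 a : ~~ level I a.+1 -> level I a.+2 -> beta a.+2 = (beta a).+1.
Proof.
move=> nla la2; rewrite 2!betaS la2 (negbTE nla) (not_level_wx kn HI Hw _ nla) ?addn0 ?addn1 //.
by rewrite (leq_trans _ (level_le HI la2)).
Qed.

Let step1 a : level I a -> level I a.+1 -> slow beta a a.+1 1.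
Proof. by move=> la la1; rewrite /slow beta1 //; case: (v _); lia. Qed.

Let step2 a : level I a -> ~~ level I a.+1 -> level I a.+2 -> slow beta a a.+2 1.
Proof. by move=> la nla la2; rewrite /slow beta2 //; lia. Qed.

Let cup_slow a b : cupb a b -> slow beta a b.+1 (bots b.+1 - bots a).
Proof.
apply: (@cup_induction (slow beta)) => [c _|c d e q q' _ _ _|||{}a {}b ab] //.
- exact: slow0.
- exact: slowD.
have [/andP[lt _] [la la1 lb lb1] [Ea _] [Eb _] _] := black_cupP ab.
have [sz le] := black_cup_size ab; have [_ /v_or] := andP ab; rewrite /slow (beta1 la la1) (beta1 lb lb1) Eb Ea.
case: (v (n - k + a)); case: (v (n - k + b)) => // _; rewrite ?Eb in sz le; lia.
Qed.

(** Only a wedge of w labelled vee by v could break the bound. If joined to a left outer point it is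
    not labelled vee; otherwise the bound at the left end of its cup carries over by [cup_slow]. *)
Let beta_le a : level I a -> beta a <= bots a.
Proof.
elim/ltn_ind: a => a IH la; have [->|a0] := posnP a; first by rewrite /beta big_geq.
have P := prev_levelP a0 la; move: la IH; clear a0.
case: P => {}a lb Ea Et Eb la IH; last first.
- by rewrite beta2 // Eb ltnS; apply: IH => //; lia.
- by rewrite beta1 // Eb; have := IH a (ltnSn a) lb; case: (v _); lia.
have an : a < n := level_le HI la.
have aN : n - k + a < 2 * n by lia.
have [|s st] := ex_arch_left (height_nonneg kn HI Hw) aN; first by rewrite Ea.
have [sl|sl] := ltnP s (n - k).
  have := v_or st; rewrite v_std.1 // => nv.
  by rewrite beta1 // Eb; move: nv; case: (v _) => // _; rewrite addn0 IH.
have sE : s = n - k + (s - (n - k)) by lia.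
set c := s - (n - k) in sE; rewrite sE in st.
have ca : cupb c a by rewrite /black_cup an.
have [/andP[lt _] [lc _ _ _] _ _ _] := black_cupP ca; have [_ le] := black_cup_size ca.
by have [+ _] := cup_slow ca; have := IH c _ lc; lia.
Qed.

(** The mirror argument, bounding the growth of i - beta i by that of [tops]; at a = 0 it gives beta
    n >= k. *)
Let beta_top a : level I a -> n + beta a <= a + beta n + (tops n - tops a).
Proof.
have [m] := ubnP (n - a); elim: m a => // m IH a lbm la.
have := level_le HI la; rewrite leq_eqVlt => /orP[/eqP ->|an]; first by rewrite leq_addr.
have tle b : level I b -> tops b <= tops n.
  by move=> lb; rewrite (topsn kn HI Hw) (tops_le Hw).
case: (next_levelP la an) => la1 Ea Et Eb.
- have := IH a.+1 _ la1; have := tle _ la1; rewrite beta1 //; case: (v _); lia.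
- have aN : n - k + a < 2 * n by lia.
  have [|t st] := ex_arch_right (height_nonneg kn HI Hw) (height_end kn HI Hw) aN.
    by rewrite Ea.
  have [tr|tr] := leqP (2 * n - k) t.
    have := v_or st; rewrite (negbTE (v_std.2 t _)); last by case/archP: st => /andP[]; lia.
    have := IH a.+1 _ la1; have := tle _ la1; rewrite beta1 //; case: (v _); lia.
  have lt : n - k + a < t by case/archP: st => /andP[].
  have tE : t = n - k + (t - (n - k)) by lia.
  set d := t - (n - k) in tE; rewrite tE in st.
  have ad : cupb a d by rewrite /black_cup /arch_of st andbT; lia.
  have [/andP[ad' _] [_ _ _ ld] _ _ E] := black_cupP ad; have [_ le] := black_cup_size ad.
  have [_ s2] := cup_slow ad; have := IH d.+1 _ ld; have := tle _ ld; lia.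
- have := IH a.+2 _ la1; have := tle _ la1; rewrite beta2 //; lia.
Qed.

Lemma orients_admissible : admissible beta.
Proof.
split=> //; first by rewrite /beta big_geq.
have := beta_le (leveln HI); have := beta_top (a := 0) isT.
rewrite (tops0 kn HI Hw) (topsn kn HI Hw) (botsn kn HI Hw) [beta 0]big_geq //; lia.
Qed.

End OrientsAdmissible.
End Chains.

(** * Linear algebra of the nilpotent map *)

Local Open Scope ring_scope.

Section Nilpotent.

Variables (C : fieldType) (n k : nat).

Notation N := (Nmx C n k).
Notation P := (Pmx C n k).
Notation Q := (Qmx C n k).

(* Its row space is <e_1, ..., e_t, f_1, ..., f_b>. *)
Definition boxmx t b : 'M[C]_n :=
  \matrix_(i, j) ((i == j) && ((i < t)%N || ((n - k <= i)%N && (i < n - k + b)%N)))%:R.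

Lemma mul_diagE m (U : 'M[C]_(m, n)) (p : pred 'I_n) :
  U *m (\matrix_(i, j) ((i == j) && p i)%:R) = \matrix_(i, j) (if p j then U i j else 0).
Proof.
apply/matrixP=> i j; rewrite !mxE (bigD1 j) //= big1 => [|l lj].
  by rewrite !mxE eqxx addr0; case: (p j); rewrite ?mulr1 ?mulr0.
by rewrite !mxE (negbTE lj) mulr0.
Qed.

Lemma mul_box m (U : 'M[C]_(m, n)) t b :
  U *m boxmx t b =
  \matrix_(i, j) (if (j < t)%N || (n - k <= j < n - k + b)%N then U i j else 0).
Proof. exact: mul_diagE. Qed.

Lemma mulP m (U : 'M[C]_(m, n)) : U *m P = \matrix_(i, j) (if (j < n - k)%N then U i j else 0).
Proof. exact: mul_diagE. Qed.

Lemma mulQ m (U : 'M[C]_(m, n)) : U *m Q = \matrix_(i, j) (if (n - k <= j)%N then U i j else 0).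
Proof. exact: mul_diagE. Qed.

Lemma sub_boxP m (U : 'M[C]_(m, n)) t b :
  reflect (forall i (j : 'I_n), ~~ ((j < t)%N || (n - k <= j < n - k + b)%N) -> U i j = 0) (U <= boxmx t b)%MS.
Proof.
apply: (iffP submxP) => [[X ->] i j nj|H]; first by rewrite mul_box mxE (negbTE nj).
by exists U; rewrite mul_box; apply/matrixP=> i j; rewrite mxE; case: ifPn => // /H ->.
Qed.

Lemma subPP m (U : 'M[C]_(m, n)) : reflect (U *m P = U) (U <= P)%MS.
Proof.
apply: (iffP submxP) => [[X ->]|<-]; last by exists U.
by rewrite !mulP; apply/matrixP=> i j; rewrite !mxE; case: ifP => // ->.
Qed.

Lemma subQP m (U : 'M[C]_(m, n)) : reflect (U *m Q = U) (U <= Q)%MS.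
Proof.
apply: (iffP submxP) => [[X ->]|<-]; last by exists U.
by rewrite !mulQ; apply/matrixP=> i j; rewrite !mxE; case: ifP => // ->.
Qed.

Lemma mulPQ : P *m Q = 0.
Proof. by rewrite mulQ; apply/matrixP=> i j; rewrite !mxE; case: ifP => // h; case: eqP => //= ->; rewrite ltnNge h. Qed.

Lemma mulQP : Q *m P = 0.
Proof. by rewrite mulP; apply/matrixP=> i j; rewrite !mxE; case: ifP => // h; case: eqP => //= ->; rewrite leqNgt h. Qed.

Lemma addPQ : P + Q = 1%:M.
Proof.
apply/matrixP=> i j; rewrite !mxE; case: eqP => //= _; last by rewrite addr0.
by case: ltnP; rewrite ?addr0 ?add0r.
Qed.

(* Takes the value 0 when [j] is out of range. *)
Definition entry m (U : 'M[C]_(m, n)) (i : 'I_m) (j : nat) : C :=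
  if insub j is Some j' then U i j' else 0.

Lemma entryE m (U : 'M[C]_(m, n)) i (j : 'I_n) : entry U i j = U i j.
Proof. by rewrite /entry valK. Qed.

Lemma mulN m (U : 'M[C]_(m, n)) i (j : 'I_n) :
  (U *m N) i j = if (j.+1 < n)%N && (j.+1 != n - k)%N then entry U i j.+1 else 0.
Proof.
rewrite !mxE; case: ifP => [/andP[jn nj]|nj].
  rewrite (bigD1 (Ordinal jn)) //= big1 => [|l lj]; last first.
    by rewrite !mxE; case: eqP => [E|]; rewrite ?mulr0 //; case/eqP: lj; apply: val_inj.
  by rewrite -[j.+1]/(val (Ordinal jn)) entryE !mxE /= eqxx nj mulr1 addr0.
rewrite big1 // => l _; rewrite !mxE; case: eqP => [E|]; rewrite ?mulr0 //=.
by move: nj; rewrite E ltn_ord /= => ->; rewrite mulr0.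
Qed.

Lemma mulNq m (U : 'M[C]_(m, n)) q i (j : 'I_n) :
  (U *m N ^+ q) i j =
    if (j + q < n - k)%N || (n - k <= j)%N && (j + q < n)%N then entry U i (j + q) else 0.
Proof.
elim: q U => [|q IH] U.
  rewrite expr0 mulmx1 addn0 entryE ifT //.
  by rewrite ltn_ord andbT; case: ltnP.
rewrite exprS mulmxA IH addnS; case: ifP => jq; last by rewrite ifF //; lia.
have jn : (j + q < n)%N by lia.
rewrite -[(j + q)%N]/(val (Ordinal jn)) entryE mulN /=.
by case: ifP; case: ifP => //; lia.
Qed.

Lemma expNn : N ^+ n = 0.
Proof.
apply/matrixP=> i j; rewrite -[N ^+ n]mul1mx mulNq mxE ifF //; lia.
Qed.

Lemma ker_Nq m (U : 'M[C]_(m, n)) q : U *m N ^+ q = 0 -> (U <= boxmx q q)%MS.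
Proof.
move=> U0; apply/sub_boxP => i j nj; have jn := ltn_ord j.
have j'n : (j - q < n)%N by lia.
have := congr1 (fun M : 'M_(m, n) => M i (Ordinal j'n)) U0.
rewrite mulNq mxE /= ifT; last by lia.
by rewrite (_ : (j - q + q)%N = j) ?entryE //; lia.
Qed.

Lemma box_Nq t b q : (t <= n - k)%N -> (boxmx t b *m N ^+ q <= boxmx (t - q) (b - q))%MS.
Proof.
move=> tn; apply/sub_boxP => i j nj; rewrite mulNq; case: ifP => // jq.
have jn : (j + q < n)%N by lia.
rewrite -[(j + q)%N]/(val (Ordinal jn)) entryE mxE /=.
by case: eqP => //= ->; rewrite (_ : _ || _ = false) //=; lia.
Qed.

Lemma comm_PN : P *m N = N *m P.
Proof.
rewrite -[P in LHS]mul1mx -[N in RHS]mul1mx mulP; apply/matrixP=> i j.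
rewrite mulN mulP [RHS]mxE mulN; case: ifP => [/andP[jn nj]|_]; last by rewrite if_same.
rewrite -[j.+1]/(val (Ordinal jn)) !entryE [LHS]mxE /=.
by rewrite [in RHS]leq_eqVlt (negbTE nj).
Qed.

Lemma comm_QN : Q *m N = N *m Q.
Proof.
have -> : Q = 1%:M - P by rewrite -addPQ addrC addKr.
by rewrite mulmxBl mulmxBr mul1mx mulmx1 comm_PN.
Qed.

Lemma comm_PNq q : P *m N ^+ q = N ^+ q *m P.
Proof.
elim: q => [|q IH]; first by rewrite expr0 mulmx1 mul1mx.
by rewrite exprS -mulmxE mulmxA comm_PN -mulmxA IH mulmxA.
Qed.

Lemma comm_QNq q : Q *m N ^+ q = N ^+ q *m Q.
Proof.
elim: q => [|q IH]; first by rewrite expr0 mulmx1 mul1mx.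
by rewrite exprS -mulmxE mulmxA comm_QN -mulmxA IH mulmxA.
Qed.

Lemma kerQ : (kermx Q :=: P)%MS.
Proof.
apply/eqmxP/andP; split; last by apply/sub_kermxP; exact: mulPQ.
apply/subPP; have /sub_kermxP := submx_refl (kermx Q).
by rewrite -[X in _ -> _ = X]mulmx1 -addPQ mulmxDr => ->; rewrite addr0.
Qed.

Lemma rank_split m (U : 'M[C]_(m, n)) : (\rank (U *m Q) + \rank (U :&: P)%MS)%N = \rank U.
Proof. by rewrite -[RHS](mxrank_mul_ker U Q) (cap_eqmx (eqmx_refl U) kerQ). Qed.

Lemma rank_box11 (p : pred 'I_n) : {in p &, forall i j, i = j} ->
  (\rank (\matrix_(i < n, j < n) ((i == j) && p i)%:R : 'M[C]_n) <= 1)%N.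
Proof.
move=> p1; rewrite (_ : \matrix_(i, j) _ =
    (\col_(i < n) (p i)%:R : 'cV[C]_n) *m (\row_(j < n) (p j)%:R)).
  exact: mulmx_max_rank.
apply/matrixP=> i j; rewrite !mxE big_ord1 !mxE.
case pi: (p i); last by rewrite andbF mul0r.
case pj: (p j); first by rewrite (p1 i j) // eqxx mul1r.
by rewrite mulr0; case: eqP => // E; rewrite E pj in pi.
Qed.

Lemma rank_ker_P : (\rank (P :&: kermx N)%MS <= 1)%N.
Proof.
apply: leq_trans (rank_box11 (p := fun i => (i < 1)%N && (i < n - k)%N) _); last first.
  by move=> i j /andP[i1 _] /andP[j1 _]; apply: val_inj => /=; lia.
apply: mxrankS; set K := (_ :&: _)%MS.
have /subPP KP : (K <= P)%MS by exact: capmxSl.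
have /sub_kermxP KN : (K <= kermx N)%MS by exact: capmxSr.
have /sub_boxP K1 : (K <= boxmx 1 1)%MS by apply: ker_Nq; rewrite expr1.
apply/submxP; exists K; rewrite mul_diagE; apply/matrixP=> i j; rewrite mxE.
case: ifPn => // nj; have [jn|jn] := ltnP j (n - k); last first.
  by rewrite -KP mulP mxE ltnNge jn.
by apply: K1; lia.
Qed.

Lemma rank_ker_Q : (\rank (Q :&: kermx N)%MS <= 1)%N.
Proof.
apply: leq_trans (rank_box11 (p := fun i => (i == n - k :> nat)%N) _); last first.
  by move=> i j /eqP i1 /eqP j1; apply: val_inj => /=; lia.
apply: mxrankS; set K := (_ :&: _)%MS.
have /subQP KP : (K <= Q)%MS by exact: capmxSl.
have /sub_kermxP KN : (K <= kermx N)%MS by exact: capmxSr.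
have /sub_boxP K1 : (K <= boxmx 1 1)%MS by apply: ker_Nq; rewrite expr1.
apply/submxP; exists K; rewrite mul_diagE; apply/matrixP=> i j; rewrite mxE.
case: ifPn => // nj; have [jn|jn] := ltnP j (n - k).
  by rewrite -KP mulQ mxE leqNgt jn.
by apply: K1; lia.
Qed.

(** With a kernel of dimension at most one on X, each application of N loses at most one
    dimension. *)
Lemma rank_Nq (X : 'M[C]_n) m (W : 'M[C]_(m, n)) q :
  (\rank (X :&: kermx N)%MS <= 1)%N -> (X *m N <= X)%MS -> (W <= X)%MS ->
  (\rank W <= \rank (W *m N ^+ q) + q)%N.
Proof.
move=> X1 XN; elim: q W => [|q IH] W WX; first by rewrite expr0 mulmx1 addn0.
rewrite exprS mulmxA addnS -addSn.
have WN : (W *m N <= X)%MS by apply: submx_trans XN; apply: submxMr.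
have := IH _ WN; rewrite -(mxrank_mul_ker W N).
have : (\rank (W :&: kermx N)%MS <= 1)%N.
  by apply: leq_trans X1; apply/mxrankS/capmxS.
by lia.
Qed.

Lemma PN_sub : (P *m N <= P)%MS.
Proof. by rewrite comm_PN submxMl. Qed.

Lemma QN_sub : (Q *m N <= Q)%MS.
Proof. by rewrite comm_QN submxMl. Qed.

Lemma rank_Nq_P m (W : 'M[C]_(m, n)) q : (W <= P)%MS -> (\rank W <= \rank (W *m N ^+ q) + q)%N.
Proof. exact: rank_Nq rank_ker_P PN_sub. Qed.

Lemma rank_Nq_Q m (W : 'M[C]_(m, n)) q : (W <= Q)%MS -> (\rank W <= \rank (W *m N ^+ q) + q)%N.
Proof. exact: rank_Nq rank_ker_Q QN_sub. Qed.

(** On a nonzero stable subspace a nilpotent map has a strictly smaller image. *)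
Lemma nilpotent_stable m (U : 'M[C]_(m, n)) : (U *m N <= U)%MS -> U *m N ^+ (\rank U) = 0.
Proof.
have [r] := ubnP (\rank U); elim: r m U => // r IH m U ltUr UN.
have [U0|nU0] := eqVneq (\rank U) 0%N.
  by rewrite U0; move/eqP: U0; rewrite mxrank_eq0 => /eqP ->; rewrite mul0mx.
have ltN : (\rank (U *m N) < \rank U)%N.
  rewrite ltn_neqAle mxrankS // andbT; apply: contra nU0 => E.
  have sUN : (U <= U *m N)%MS by rewrite -(geq_leqif (mxrank_leqif_sup UN)) (eqP E).
  suff H q : (U <= U *m N ^+ q)%MS.
    by have := H n; rewrite expNn mulmx0 => /submx0null ->; rewrite mxrank0.
  elim: q => [|q IHq]; first by rewrite expr0 mulmx1.
  by apply: submx_trans sUN _; rewrite exprSr mulmxA; apply: submxMr.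
have {}IH : U *m N *m N ^+ (\rank (U *m N)) = 0.
  by apply: IH; [apply: leq_trans ltN _|apply: submxMr].
rewrite (_ : \rank U = (\rank (U *m N)).+1 + (\rank U - (\rank (U *m N)).+1))%N; last by lia.
by rewrite exprD exprS -!mulmxE !mulmxA IH mul0mx.
Qed.

(** N^t kills the part in P and N^b the part in Q, and each power costs at most one dimension. *)
Lemma rank_box t b : (t <= n - k)%N -> (\rank (boxmx t b) <= t + b)%N.
Proof.
move=> tn; rewrite -(rank_split (boxmx t b)) addnC; apply: leq_add.
- apply: leq_trans (rank_Nq_P t (capmxSr _ _)) _.
  rewrite (_ : \rank _ = 0%N) //; apply/eqP; rewrite mxrank_eq0 -submx0.
  set U := (_ :&: _)%MS; have UP : (U <= P)%MS := capmxSr _ _.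
  have : (U *m N ^+ t <= boxmx 0 (b - t))%MS.
    by apply: submx_trans (submxMr _ (capmxSl _ _)) _; rewrite -[0%N](subnn t); apply: box_Nq.
  move=> /sub_boxP H; have : (U *m N ^+ t <= P)%MS.
    by apply/subPP; rewrite -mulmxA -comm_PNq mulmxA; have /subPP -> := UP.
  move=> /subPP E; rewrite -E mulP submx0; apply/eqP/matrixP=> i j; rewrite [LHS]mxE [RHS]mxE.
  by case: ifP => // jn; apply: H; lia.
- apply: leq_trans (rank_Nq_Q b (submxMl _ _)) _.
  rewrite (_ : \rank _ = 0%N) //; apply/eqP; rewrite mxrank_eq0.
  rewrite -mulmxA comm_QNq mulmxA mulQ; apply/eqP/matrixP=> i j; rewrite [LHS]mxE [RHS]mxE.
  have /sub_boxP H := box_Nq b b tn.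
  by case: ifP => // jn; apply: H; lia.
Qed.

End Nilpotent.

Section Boxes.

Variables (C : fieldType) (n k : nat).
Hypothesis kn : (2 * k <= n)%N.

Notation N := (Nmx C n k).
Notation P := (Pmx C n k).
Notation Q := (Qmx C n k).
Notation box := (boxmx C n k).

Lemma box_mono t b t' b' : (t <= t')%N -> (b <= b')%N -> (box t b <= box t' b')%MS.
Proof.
move=> tt bb; apply/sub_boxP => i j nj; rewrite mxE.
by case: eqP => //= ->; rewrite (_ : _ || _ = false) //; lia.
Qed.

Let if_natr (p q r : bool) : r = p && q -> (if p then q%:R else 0) = r%:R :> C.
Proof. by move=> ->; case: p. Qed.

Lemma boxP t b : (t <= n - k)%N -> box t b *m P = box t 0.
Proof.
move=> tn; rewrite mulP; apply/matrixP=> i j; rewrite !mxE; apply: if_natr.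
by case: eqP => [->|_] /=; rewrite ?andbF //; lia.
Qed.

Lemma boxQ t b : (t <= n - k)%N -> box t b *m Q = box 0 b.
Proof.
move=> tn; rewrite mulQ; apply/matrixP=> i j; rewrite !mxE; apply: if_natr.
by case: eqP => [->|_] /=; rewrite ?andbF //; lia.
Qed.

Lemma PE : P = box (n - k) 0.
Proof.
by apply/matrixP=> i j; rewrite !mxE (_ : _ || _ = (i < n - k)%N) //; lia.
Qed.

Lemma QE : Q = box 0 k.
Proof.
apply/matrixP=> i j; rewrite !mxE (_ : _ || _ = (n - k <= i)%N) //; have := ltn_ord i; lia.
Qed.

(** The upper bounds n - k and k add up to n, which is the sum of the two ranks; so both are
    attained. *)
Lemma rankPQ : \rank P = (n - k)%N /\ \rank Q = k.
Proof.
have : (\rank (box (n - k) 0) <= n - k + 0)%N by exact: rank_box.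
have : (\rank (box 0 k) <= 0 + k)%N by exact: rank_box.
rewrite -PE -QE; have := rank_split k (1%:M : 'M[C]_n).
by rewrite mul1mx mxrank1 (cap1mx P); lia.
Qed.

Lemma rank_boxE t b : (t <= n - k)%N -> (b <= k)%N -> \rank (box t b) = (t + b)%N.
Proof.
move=> tn bk; apply/eqP; rewrite eqn_leq rank_box //= -(rank_split k (box t b)) addnC leq_add //.
  rewrite boxQ //; have [_ rQ] := rankPQ.
  have := rank_Nq_Q (k - b) (submx_refl Q); rewrite rQ.
  have : (Q *m N ^+ (k - b) <= box 0 b)%MS.
    by rewrite QE; apply: submx_trans (box_Nq _ _ _ _) (box_mono _ _); lia.
  by move/mxrankS; lia.
have [rP _] := rankPQ.
have := rank_Nq_P (n - k - t) (submx_refl P); rewrite rP.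
have : (P *m N ^+ (n - k - t) <= box t b :&: P)%MS.
  rewrite sub_capmx comm_PNq submxMl -comm_PNq PE andbT.
  by apply: submx_trans (box_Nq _ _ _ _) (box_mono _ _); lia.
by move/mxrankS; lia.
Qed.

Lemma box00 : box 0 0 = 0.
Proof. by apply/matrixP=> i j; rewrite !mxE (_ : _ || _ = false) ?andbF //; lia. Qed.

End Boxes.

(** * Frames of partial flags *)

Section Lead.

Variables (C : fieldType) (n : nat).

(* Its row space is the [i]-dimensional member of the flag represented by [g]. *)
Definition lead (g : 'M[C]_n) (i : nat) : 'M[C]_n := pid_mx i *m g.

Lemma lead0 g : lead g 0 = 0.
Proof. by rewrite /lead pid_mx_0 mul0mx. Qed.

Lemma leadn g : lead g n = g.
Proof. by rewrite /lead pid_mx_1 mul1mx. Qed.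

Lemma pid_lead g a b : (a <= b)%N -> pid_mx a *m lead g b = lead g a.
Proof. by move=> ab; rewrite /lead mulmxA mul_pid_mx pid_mx_minv (minn_idPl ab). Qed.

Lemma lead_mono g a b : (a <= b)%N -> (lead g a <= lead g b)%MS.
Proof. by move=> ab; rewrite -(pid_lead g ab) submxMl. Qed.

Lemma leadE g a i j : lead g a i j = if (i < a)%N then g i j else 0.
Proof.
rewrite mxE (bigD1 i) //= big1 => [|l li].
  by rewrite !mxE eqxx addr0; case: ifP; rewrite ?mul1r ?mul0r.
by rewrite !mxE eq_sym; case: eqP => [E|]; rewrite ?mul0r //; case/eqP: li; apply: val_inj.
Qed.

Lemma rank_lead g a : g \in unitmx -> (a <= n)%N -> \rank (lead g a) = a.
Proof. by move=> gu an; rewrite mxrankMfree ?row_free_unit // rank_pid_mx. Qed.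

Lemma flag_ofE I g l : flag_of I g l = lead g (ii I l).
Proof. by apply/matrixP=> i j; rewrite mxE leadE. Qed.

Lemma sub_lead_row (g : 'M[C]_n) (i : 'I_n) a : (i < a)%N -> (row i g <= lead g a)%MS.
Proof.
move=> ia; suff -> : row i g = row i (lead g a) by exact: row_sub.
by apply/rowP=> j; rewrite [LHS]mxE [RHS]mxE leadE ia.
Qed.

(** A basis of a complement of F_l in F_{l+1} is appended to a frame of F_l, level by level. *)
Lemma is_flag_frame I (F : flag C n) : valid_type n I -> is_flag I F ->
  exists2 g, g \in unitmx & forall l, (l <= size I)%N -> (lead g (ii I l) == fl F l)%MS.
Proof.
move=> HI HF.
suff H l : (l <= size I)%N ->
    exists h, forall l', (l' <= l)%N -> (lead h (ii I l') == fl F l')%MS.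
  have [g gP] := H _ (leqnn _); exists g => //.
  have /andP[_] := gP _ (leqnn _); rewrite (ii_size HI) leadn.
  have m0 : (0 < size I)%N by have [] := HI; case: (I).
  have [|rF _] := HF (size I); first by rewrite m0 leqnn.
  rewrite -row_full_unit -sub1mx => sF; apply: submx_trans sF.
  rewrite (ii_size HI) in rF; rewrite sub1mx /row_full.
  by case: (size I) m0 rF => // m _ /= ->.
elim: l => [|l IH] ls; first by exists 0 => l'; rewrite leqn0 => /eqP->; rewrite lead0 /= submx_refl.
have [h hP] := IH (ltnW ls); pose d := ii I l; pose D := row_base (F l.+1 :\: fl F l)%MS.
have lt : (d < ii I l.+1)%N by apply: (ii_lt HI).
have [rF] := HF l.+1 ls; rewrite [l.+1.-1]/= => sF.
have rFl : \rank (fl F l) = d.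
  by rewrite /d; case: (l) ls => [|l0] ls0; [rewrite /= mxrank0|case: (HF l0.+1 (ltnW ls0))].
have rD : \rank (F l.+1 :\: fl F l)%MS = (ii I l.+1 - d)%N.
  have := mxrank_cap_compl (F l.+1) (fl F l).
  by rewrite (capmx_idPr sF) rF rFl; lia.
(* Rows from d on are those of [D]; the rows beyond level l+1 are 0 and get overwritten at later
   levels. *)
pose h' : 'M[C]_n := \matrix_(i, j) (if (i < d)%N then h i j
  else if insub (i - d)%N is Some i' then D i' j else 0).
have leadh' a : (a <= d)%N -> lead h' a = lead h a.
  move=> ad; apply/matrixP=> i j; rewrite !leadE; case: ifP => // ia.
  by rewrite mxE (leq_trans ia ad).
exists h' => l'; rewrite leq_eqVlt => /orP[/eqP->|l'l]; last first.
  rewrite leadh' ?hP //; move: l'l; rewrite ltnS leq_eqVlt => /orP[/eqP->//|lt'].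
  exact: ltnW (ii_lt HI lt' (ltnW ls)).
have sub : (F l.+1 <= lead h' (ii I l.+1))%MS.
  rewrite -(addsmx_diff_cap_eq (F l.+1) (fl F l)) addsmx_sub; apply/andP; split.
    rewrite -(eq_row_base (F l.+1 :\: fl F l)%MS) -/D; apply/row_subP => i.
    have iN : (d + i < n)%N.
      have := ltn_ord i; rewrite [X in (_ < X)%N -> _]rD.
      have := level_le HI (level_ii ls); lia.
    have -> : row i D = row (Ordinal iN) h'.
      by apply/rowP=> j; rewrite [LHS]mxE [RHS]mxE [RHS]mxE /= ltnNge leq_addr /= addKn valK.
    by apply: sub_lead_row; have := ltn_ord i; rewrite [X in (_ < X)%N -> _]rD [nat_of_ord (Ordinal _)]/=; lia.
  apply: submx_trans (capmxSr _ _) _.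
  have /andP[_ s1] := hP l (leqnn l); apply: submx_trans s1 _.
  by rewrite -/d -leadh' // lead_mono // ltnW.
apply/andP; split; last exact: sub.
rewrite -(geq_leqif (mxrank_leqif_sup sub)) rF.
apply: leq_trans (mxrankM_maxl _ _) _; rewrite rank_pid_mx // (level_le HI) //.
  exact: level_ii.
exact: level_ii.
Qed.

End Lead.

(** * The closed conditions *)

Section ClosedCell.

Variables (C : fieldType) (n k : nat) (I : seq nat).
Hypothesis kn : (2 * k <= n)%N.
Hypothesis HI : valid_type n I.

Notation N := (Nmx C n k).
Notation P := (Pmx C n k).
Notation Q := (Qmx C n k).
Notation box := (boxmx C n k).

Definition drops (g : 'M[C]_n) a b q := (lead g b *m N ^+ q <= lead g a)%MS.

Lemma drops0 g a : drops g a a 0.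
Proof. by rewrite /drops expr0 mulmx1. Qed.

Lemma dropsD g a b c q q' : drops g a b q -> drops g b c q' -> drops g a c (q + q').
Proof.
move=> ab bc; apply: submx_trans ab; rewrite addnC exprD -mulmxE mulmxA.
exact: submxMr.
Qed.

(** The bound on rho is written as annihilation by a power of N, whose kernel in Q is the span of
    the first f's: this form is visibly polynomial in g. *)
Record closed_cell (w : tableau) (g : 'M[C]_n) : Prop := ClosedCell {
  cc_step1 : forall a, level I a -> level I a.+1 -> drops g a a.+1 1;
  cc_step2 : forall a, level I a -> ~~ level I a.+1 -> level I a.+2 -> drops g a a.+2 1;
  cc_cup : forall a b, black_cup n k I w a b -> drops g a b.+1 (bots w b.+1 - bots w a);
  cc_box : forall a, level I a -> lead g a *m Q *m N ^+ (bots w a) = 0 }.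

Definition image_rank (g : 'M[C]_n) (i : nat) : nat := \rank (lead g i *m Q).

(** N^q commutes with rho and preserves P, and it loses at most q dimensions on each of Q and P. *)
Lemma drops_slow g a b q : g \in unitmx -> (a <= n)%N -> (b <= n)%N -> drops g a b q ->
  slow (image_rank g) a b q.
Proof.
move=> gu an bn ab; have := rank_split k (lead g a); have := rank_split k (lead g b).
rewrite !rank_lead // -/(image_rank g a) -/(image_rank g b) => eb ea; split.
  apply: leq_trans (rank_Nq_Q q (submxMl _ _)) _; rewrite leq_add2r mxrankS //.
  by rewrite -mulmxA comm_QNq mulmxA submxMr.
suff : (\rank (lead g b :&: P)%MS <= \rank (lead g a :&: P)%MS + q)%N by lia.
apply: leq_trans (rank_Nq_P q (capmxSr _ _)) _; rewrite leq_add2r mxrankS // sub_capmx.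
rewrite (submx_trans (submxMr _ (capmxSl _ _)) ab) /=.
by apply/subPP; rewrite -mulmxA -comm_PNq mulmxA; have /subPP -> := capmxSr (lead g b) P.
Qed.

Section OneTableau.

Variable w : tableau.
Hypothesis Hw : is_rst n k I w.

Lemma closed_cell_admissible g : g \in unitmx -> closed_cell w g ->
  admissible n k I w (image_rank g).
Proof.
move=> gu [s1 s2 cu bo]; split.
- by rewrite /image_rank lead0 mul0mx mxrank0.
- rewrite /image_rank leadn; have [_ {2}<-] := rankPQ C kn.
  by rewrite (eqmxMfull Q _) // row_full_unit.
- by move=> a la la1; apply: drops_slow; rewrite ?(level_le HI) //; apply: s1.
- by move=> a la nla la2; apply: drops_slow; rewrite ?(level_le HI) //; apply: s2.
- move=> a b ab; have [lt [la _ _ lb] _ _ _] := black_cupP kn HI Hw ab.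
  by apply: drops_slow; rewrite ?(level_le HI) //; apply: cu.
- move=> a la; apply: leq_trans (rank_Nq_Q (bots w a) (submxMl _ _)) _.
  by rewrite bo // mxrank0.
Qed.

Lemma admissible_bounds beta a : admissible n k I w beta -> level I a ->
  [/\ (beta a <= k)%N, (a - beta a <= n - k)%N & (beta a <= a)%N].
Proof.
move=> adm la; have an := level_le HI la.
suff : (beta a <= beta n)%N /\ (a + beta n <= n + beta a)%N.
  rewrite (admn adm) => -[h1 h2]; have := adm_le adm la; have := tops_bots kn HI Hw la.
  by split; lia.
have [m] := ubnP (n - a); elim: m a la {an} => // m IH a la lbm.
have := level_le HI la; rewrite leq_eqVlt => /orP[/eqP ->|an]; first by rewrite leqnn addnC.
case: (next_levelP kn HI Hw la an) => la1.
- by move=> _ _ _; have [//||] := IH a.+1; [lia|have [] := adm_step1 adm la la1; lia].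
- by move=> _ _ _; have [//||] := IH a.+1; [lia|have [] := adm_step1 adm la la1; lia].
- by move=> nla _ _; have [//||] := IH a.+2; [lia|have [] := adm_step2 adm la nla la1; lia].
Qed.

(** N^q lowers both parameters of a coordinate subspace by q, so the two inequalities of [slow] are
    all that an inclusion asks for. *)
Lemma box_closed_cell g beta : admissible n k I w beta ->
  (forall a, level I a -> (lead g a == box (a - beta a) (beta a))%MS) -> closed_cell w g.
Proof.
move=> adm gP.
have drp a b q : level I a -> level I b -> slow beta a b q -> drops g a b q.
  move=> la lb [s1 s2]; have /andP[_ ga] := gP a la; have /andP[gb _] := gP b lb.
  have [_ ba _] := admissible_bounds adm la; have [_ bb ?] := admissible_bounds adm lb.
  apply: submx_trans ga; apply: submx_trans (submxMr _ gb) _.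
  by apply: submx_trans (box_Nq _ _ _ bb) (box_mono C kn _ _); lia.
split=> [a la la1|a la nla la2|a b ab|a la].
- by apply: drp => //; apply: (adm_step1 adm).
- by apply: drp => //; apply: (adm_step2 adm).
- have [_ [la _ _ lb] _ _ _] := black_cupP kn HI Hw ab.
  by apply: drp => //; apply: (adm_cup adm).
have [_ bb _] := admissible_bounds adm la; have /andP[ga _] := gP a la.
apply/eqP; rewrite -submx0 -(box00 C kn).
apply: submx_trans (submxMr _ (submxMr _ ga)) _; rewrite boxQ //.
by apply: submx_trans (box_Nq _ _ _ _) (box_mono C kn _ _); have := adm_le adm la; lia.
Qed.

Lemma steps_inY g :
  (forall a, level I a -> level I a.+1 -> drops g a a.+1 1) ->
  (forall a, level I a -> ~~ level I a.+1 -> level I a.+2 -> drops g a a.+2 1) ->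
  g \in unitmx -> inY k I (flag_of I g).
Proof.
move=> s1 s2 gu; have flE l : (l <= size I)%N -> fl (flag_of I g) l = lead g (ii I l).
  by case: l => [|l] _; [rewrite lead0|rewrite /= flag_ofE].
split=> -[|l] // ls; rewrite [l.+1.-1]/= (flE l (ltnW ls)) flag_ofE.
  split; first by rewrite rank_lead // (level_le HI) // level_ii.
  by rewrite lead_mono // ltnW // (ii_lt HI).
have lt := ii_lt HI (ltnSn l) ls; have le := gap_le2 kn HI Hw ls.
have ll := level_ii (ltnW ls); have ll1 := level_ii ls.
have [E|E] : (ii I l.+1 = (ii I l).+1) \/ (ii I l.+1 = (ii I l).+2) by lia.
  by have := s1 _ ll; rewrite -E => /(_ ll1).
have := s2 _ ll; rewrite -E; apply=> //; apply/negP => /levelP[l' ls' E'].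
have := ii_lt_inv HI (ltnW ls) ls'; have := ii_lt_inv HI ls' ls; lia.
Qed.

Lemma inY_steps g : inY k I (flag_of I g) ->
  (forall a, level I a -> level I a.+1 -> drops g a a.+1 1) /\
  (forall a, level I a -> ~~ level I a.+1 -> level I a.+2 -> drops g a a.+2 1).
Proof.
have flE l : fl (flag_of I g) l = lead g (ii I l).
  by case: l => [|l]; [rewrite lead0|rewrite /= flag_ofE].
case=> _ H; have {}H l : (l < size I)%N -> drops g (ii I l) (ii I l.+1) 1.
  by move=> ls; have := H l.+1 ls; rewrite flE flag_ofE /drops expr1.
have prv a b : level I a -> level I b -> (a < b)%N -> exists l,
    [/\ (l < size I)%N, ii I l.+1 = b & (a <= ii I l)%N].
  move=> /levelP[l' ls' <-] /levelP[[|l] ls <-] lt.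
    by have := ii_lt_inv HI ls' ls lt.
  exists l; split=> //; have := ii_lt_inv HI ls' ls lt; rewrite ltnS leq_eqVlt.
  by case/orP=> [/eqP ->|lt'] //; apply: ltnW (ii_lt HI lt' (ltnW ls)).
split=> [a la la1|a la nla la2].
  have [l [ls E le]] := prv _ _ la la1 (ltnSn a); have := H l ls; rewrite E.
  by have := ii_lt HI (ltnSn l) ls; rewrite E => lt; rewrite (_ : ii I l = a) //; lia.
have [l [ls E le]] := prv _ _ la la2 (leqnSn a.+1); have := H l ls; rewrite E.
have := ii_lt HI (ltnSn l) ls; rewrite E => lt.
have ne : ii I l != a.+1 by apply: contraNneq nla => <-; apply: level_ii; lia.
by rewrite (_ : ii I l = a) //; lia.
Qed.

(** Only the cup condition needs an argument, by induction on nested cups: F_{b+1} is split into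
    F_b, which reaches F_{a+1} in c-1 steps and F_a in one more, and its part in P, a coordinate
    subspace that N^c sends into F_a cap P. *)
Lemma cell_closed_cell g : Ycell k I w (flag_of I g) -> closed_cell w g.
Proof.
case=> gY gF; have [s1 s2] := inY_steps gY.
(* Applying P and Q to the equality of F' with F(w) separates its two summands. *)
have bx a : level I a ->
    [/\ (lead g a :&: P <= box (tops w a) 0)%MS, (box (tops w a) 0 <= lead g a)%MS,
        (lead g a *m Q <= box 0 (bots w a))%MS & (box 0 (bots w a) <= lead g a *m Q)%MS].
  case/levelP => -[_ <-|l ls <-].
    rewrite lead0 (tops0 kn HI Hw) (bots0 kn HI Hw) (box00 C kn) mul0mx !sub0mx.
    by rewrite (submx_trans (capmxSl _ _)) ?sub0mx.
  have tn := tops_le Hw (ii I l.+1); have /andP[] := gF l.+1 ls.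
  rewrite /Fprime flag_ofE -[Fw _ _ _ _ _ _]/(box (tops w (ii I l.+1)) (bots w (ii I l.+1))).
  set X := lead g _; set t := tops w _; set b := bots w _ => F1 F2.
  have XP : (X :&: P)%MS *m P = (X :&: P)%MS by apply/subPP; exact: capmxSr.
  have XPQ : (X :&: P)%MS *m Q = 0 by rewrite -XP -mulmxA mulPQ mulmx0.
  have QQ : X *m Q *m Q = X *m Q by apply/subQP; exact: submxMl.
  split.
  - rewrite -XP -(boxP C kn b tn); apply: submxMr; exact: submx_trans (addsmxSl _ _) F1.
  - rewrite -(boxP C kn b tn); apply: submx_trans (submxMr _ F2) _.
    by rewrite addsmxMr XP -mulmxA mulQP mulmx0 addsmx0 capmxSl.
  - rewrite -QQ -(boxQ C kn b tn); apply: submxMr; exact: submx_trans (addsmxSr _ _) F1.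
  - rewrite -(boxQ C kn b tn); apply: submx_trans (submxMr _ F2) _.
    by rewrite addsmxMr XPQ QQ adds0mx.
split=> // [a b ab|a la]; last first.
  have [_ _ b3 _] := bx a la; apply/eqP; rewrite -submx0 -(box00 C kn).
  by apply: submx_trans (submxMr _ b3) _; rewrite -[X in (_ <= box _ X)%MS](subnn (bots w a)); apply: box_Nq.
apply: (cup_induction kn HI Hw (K := drops g)) ab => //.
- by move=> c _; apply: drops0.
- by move=> c d e q q' _ _ _; apply: dropsD.
move=> {}a {}b ab ins; have [lt [la la1 lb lb1] [Ba _] [Bb _] E] := black_cupP kn HI Hw ab.
have [sz le] := black_cup_size kn HI Hw ab.
have [_ _ b3 b4] := bx _ lb1; have [_ _ _ b4'] := bx _ lb; have [b1 _ _ _] := bx _ lb1.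
have [_ b2 _ _] := bx _ la.
(* At the wedge b the image rho does not grow, so a vector of F_{b+1} differs from one of F_b by a
   vector of P. *)
have split : (lead g b.+1 <= lead g b + (lead g b.+1 :&: P))%MS.
  rewrite Bb in b3; have /submxP[X EX] := submx_trans b3 b4'.
  rewrite -[X in (X <= _)%MS](subrK (X *m lead g b)) addrC.
  apply: addmx_sub_adds; first exact: submxMl.
  rewrite sub_capmx; apply/andP; split.
    rewrite addmx_sub // eqmx_opp; apply: submx_trans (submxMl _ _) _.
    exact: lead_mono (leqnSn b).
  by rewrite -(kerQ C n k); apply/sub_kermxP; rewrite mulmxBl EX mulmxA subrr.
apply: submx_trans (submxMr _ split) _; rewrite addsmxMr addsmx_sub; apply/andP; split.
  rewrite (_ : _ - _ = 1 + (bots w b - bots w a.+1))%N; last by clear - sz le Ba Bb lt; lia.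
  exact: dropsD (s1 _ la la1) ins.
apply: submx_trans b2; apply: submx_trans (submxMr _ b1) _.
have tn := tops_le Hw b.+1.
by apply: submx_trans (box_Nq _ _ _ tn) (box_mono C kn _ _); clear - E sz le; lia.
Qed.

Lemma closed_cell_stable g a : closed_cell w g -> level I a -> (lead g a *m N <= lead g a)%MS.
Proof.
case=> s1 s2 _ _; case: (posnP a) => [-> _|a0 la]; first by rewrite lead0 mul0mx.
rewrite -[N]expr1; case: (prev_levelP kn HI Hw a0 la) (la) => {la a0} b lb.
- by move=> _ _ _ la; apply: submx_trans (s1 _ lb la) (lead_mono _ _).
- by move=> _ _ _ la; apply: submx_trans (s1 _ lb la) (lead_mono _ _).
- by move=> nlb _ _ la; apply: submx_trans (s2 _ lb nlb la) (lead_mono _ _); lia.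
Qed.

(** F_a cap P is stable of dimension [tops w a], hence killed by that power of N and contained in
    the expected coordinate subspace; rho(F_a) is treated by [cc_box], and ranks give equality. *)
Lemma closed_cell_cell g : g \in unitmx -> closed_cell w g ->
  (forall a, level I a -> image_rank g a = bots w a) -> Ycell k I w (flag_of I g).
Proof.
move=> gu [s1 s2 cu bo] gr; split; first exact: steps_inY.
have stp a := @closed_cell_stable g a (ClosedCell s1 s2 cu bo).
move=> -[|l] // ls; rewrite /Fprime flag_ofE.
rewrite -[Fw _ _ _ _ _ _]/(box (tops w (ii I l.+1)) (bots w (ii I l.+1))).
have la := level_ii ls; move: (ii I l.+1) la => a la.
have tn := tops_le Hw a; have an := level_le HI la.
set F := (_ + _)%MS; have sF : (F <= box (tops w a) (bots w a))%MS.
  rewrite addsmx_sub; apply/andP; split.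
    have stU : ((lead g a :&: P) *m N <= lead g a :&: P)%MS.
      rewrite sub_capmx (submx_trans (submxMr _ (capmxSl _ _)) (stp a la)) /=.
      by apply: submx_trans (submxMr _ (capmxSr _ _)) (PN_sub _ _ _).
    have := nilpotent_stable stU; have := rank_split k (lead g a).
    rewrite -/(image_rank g a) gr // rank_lead // => rk.
    rewrite (_ : \rank _ = tops w a); last by have := tops_bots kn HI Hw la; lia.
    move=> /ker_Nq kr; have /subPP <- := capmxSr (lead g a) P.
    apply: submx_trans (submxMr _ kr) _; rewrite boxP //.
    exact: box_mono.
  have QQ : lead g a *m Q *m Q = lead g a *m Q by apply/subQP; exact: submxMl.
  have bk := bots_le Hw a; rewrite -QQ.
  apply: submx_trans (submxMr _ (ker_Nq (bo a la))) _; rewrite boxQ //; last by lia.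
  exact: box_mono.
apply/andP; split=> //; rewrite -(geq_leqif (mxrank_leqif_sup sF)).
apply: (@leq_trans (tops w a + bots w a)); first exact: rank_box.
rewrite (tops_bots kn HI Hw) // -{1}(rank_lead gu an).
rewrite -(rank_split k (lead g a)) -(rank_split k F); apply: leq_add; apply: mxrankS.
  have <- : lead g a *m Q *m Q = lead g a *m Q by apply/subQP; exact: submxMl.
  exact/submxMr/addsmxSr.
by rewrite sub_capmx capmxSr andbT addsmxSl.
Qed.

End OneTableau.
End ClosedCell.

(** * Zariski closure *)

Section Polynomial.

Variables (C : fieldType) (n : nat).

(* [polyfun] is not closed under pointwise equality. *)
Definition polyfun_like (f : 'M[C]_n -> C) := exists2 p, polyfun p & p =1 f.

Lemma polyfun_like_sum (J : Type) (r : seq J) (f : J -> 'M[C]_n -> C) :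
  (forall i, polyfun_like (f i)) -> polyfun_like (fun g => \sum_(i <- r) f i g).
Proof.
move=> pf; elim: r => [|i r [p pp pE]].
  by exists (fun=> 0) => [|g]; [apply: pf_const|rewrite big_nil].
have [q qq qE] := pf i; exists (fun g => q g + p g); first exact: pf_add.
by move=> g; rewrite big_cons qE pE.
Qed.

Lemma polyfun_like_prod (J : Type) (r : seq J) (f : J -> 'M[C]_n -> C) :
  (forall i, polyfun_like (f i)) -> polyfun_like (fun g => \prod_(i <- r) f i g).
Proof.
move=> pf; elim: r => [|i r [p pp pE]].
  by exists (fun=> 1) => [|g]; [apply: pf_const|rewrite big_nil].
have [q qq qE] := pf i; exists (fun g => q g * p g); first exact: pf_mul.
by move=> g; rewrite big_cons qE pE.
Qed.

Lemma polyfun_like_const c : polyfun_like (fun=> c).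
Proof. by exists (fun=> c) => //; apply: pf_const. Qed.

Lemma polyfun_like_coord i j : polyfun_like (fun g => g i j).
Proof. by exists (fun g => g i j) => //; apply: pf_coord. Qed.

Lemma polyfun_like_mul f h : polyfun_like f -> polyfun_like h -> polyfun_like (fun g => f g * h g).
Proof.
by move=> [p pp pE] [q qq qE]; exists (fun g => p g * q g) => [|g]; [apply: pf_mul|rewrite pE qE].
Qed.

Lemma polyfun_like_det m (M : 'M[C]_n -> 'M[C]_m) :
  (forall i j, polyfun_like (fun g => M g i j)) -> polyfun_like (fun g => \det (M g)).
Proof.
move=> pM; apply: polyfun_like_sum => s; apply: polyfun_like_mul.
  exact: polyfun_like_const.
by apply: polyfun_like_prod.
Qed.

Lemma polyfun_like_ext f h : f =1 h -> polyfun_like f -> polyfun_like h.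
Proof. by move=> fh [p pp pE]; exists p => // g; rewrite pE. Qed.

Lemma polyfun_like_mulmx m q r (A : 'M[C]_n -> 'M[C]_(m, q)) (B : 'M[C]_n -> 'M[C]_(q, r)) i j :
  (forall i j, polyfun_like (fun g => A g i j)) -> (forall i j, polyfun_like (fun g => B g i j)) ->
  polyfun_like (fun g => (A g *m B g) i j).
Proof.
move=> pA pB; apply: (polyfun_like_ext (f := fun g => \sum_l A g i l * B g l j)).
  by move=> g; rewrite mxE.
by apply: polyfun_like_sum => l; apply: polyfun_like_mul.
Qed.

Lemma polyfun_like_adj i j : polyfun_like (fun g => (\adj g) i j).
Proof.
apply: (polyfun_like_ext (f := fun g => (-1) ^+ (j + i) * \det (row' j (col' i g)))).
  by move=> g; rewrite mxE.
apply: polyfun_like_mul; first exact: polyfun_like_const.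
apply: polyfun_like_det => a b; apply: polyfun_like_ext (polyfun_like_coord (lift j a) (lift i b)).
by move=> g; rewrite !mxE.
Qed.

Lemma polyfun_line p (g H : 'M[C]_n) : polyfun p ->
  exists P : {poly C}, forall x, P.[x] = p (g + x *: H).
Proof.
elim=> [c|i j|p1 p2 _ [P1 E1] _ [P2 E2]|p1 p2 _ [P1 E1] _ [P2 E2]].
- by exists c%:P => x; rewrite hornerC.
- by exists ((g i j)%:P + (H i j) *: 'X) => x; rewrite !hornerE !mxE mulrC.
- by exists (P1 + P2) => x; rewrite hornerD E1 E2.
- by exists (P1 * P2) => x; rewrite hornerM E1 E2.
Qed.

End Polynomial.

Lemma all_roots_poly0 (C : numFieldType) (P : {poly C}) : (forall x, P.[x] = 0) -> P = 0.
Proof.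
move=> P0; apply: (@roots_geq_poly_eq0 _ P [seq i%:R | i <- iota 0 (size P)]).
- by apply/allP => x _; rewrite rootE P0.
- by rewrite map_inj_uniq ?iota_uniq // => i j /eqP; rewrite eqr_nat => /eqP.
- by rewrite size_map size_iota.
Qed.

(** Multiply the restriction of p to the line by the determinant and by 'X: the product vanishes at
    every x, so it is 0, and the determinant factor is not 0 because its value at 0 is det g. *)
Lemma polyfun_line_closure (C : numFieldType) n (p : 'M[C]_n -> C) (g H : 'M[C]_n) :
  polyfun p -> g \in unitmx ->
  (forall x, x != 0 -> g + x *: H \in unitmx -> p (g + x *: H) = 0) -> p g = 0.
Proof.
move=> pp gu vp; have [P PE] := polyfun_line g H pp.
have [d pd dE] : polyfun_like (fun g : 'M[C]_n => \det g).
  by apply: polyfun_like_det => i j; apply: polyfun_like_coord.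
have [D DE] := polyfun_line g H pd.
have g0 : g + 0 *: H = g by rewrite scale0r addr0.
suff : P * D * 'X = 0.
  move/eqP; rewrite !mulf_eq0 polyX_eq0 orbF => /orP[/eqP P0|/eqP D0].
    by rewrite -g0 -PE P0 horner0.
  by have := DE 0; rewrite D0 horner0 g0 dE; move: gu; rewrite unitmxE unitfE => /eqP nz /esym/nz.
apply: all_roots_poly0 => x; rewrite !hornerM hornerX PE DE dE.
have [->|x0] := eqVneq x 0; first by rewrite mulr0.
have [u|] := boolP (g + x *: H \in unitmx); first by rewrite vp // !mul0r.
by rewrite unitmxE unitfE negbK => /eqP ->; rewrite mulr0 mul0r.
Qed.

Section Closure.

Variables (C : fieldType) (n k : nat) (I : seq nat) (w : tableau).

Definition in_closure (g : 'M[C]_n) := forall p, polyfun p ->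
  (forall g', g' \in unitmx -> Ycell k I w (flag_of I g') -> p g' = 0) -> p g = 0.

Lemma in_closure_like (g : 'M[C]_n) f : in_closure g -> polyfun_like f ->
  (forall g', g' \in unitmx -> Ycell k I w (flag_of I g') -> f g' = 0) -> f g = 0.
Proof. by move=> cg [p pp pE] H; rewrite -pE; apply: cg => // g' u c; rewrite pE H. Qed.

(** Up to the factor det g, row r of g N^q adj(g) lists the coordinates of N^q g_r in the basis of
    the rows of g. The adjugate keeps them polynomial where the inverse would not. *)
Lemma dropsP (g : 'M[C]_n) a b q : g \in unitmx ->
  drops k g a b q <->
  (forall r s : 'I_n, (r < b)%N -> (a <= s)%N -> (g *m Nmx C n k ^+ q *m \adj g) r s = 0).
Proof.
move=> gu; have du : \det g \is a GRing.unit by rewrite -unitmxE.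
have pidR (M : 'M[C]_n) r s : (pid_mx b *m M) r s = if (r < b)%N then M r s else 0.
  exact: leadE.
split=> [/submxP[X EX] r s rb sa|H].
  have := congr1 (fun M => M *m \adj g) EX; rewrite /lead -!mulmxA mul_mx_adj !mulmxA.
  move=> /(congr1 (fun M : 'M_n => M r s)); rewrite -!mulmxA pidR rb => ->.
  rewrite mulmxA mul_mx_scalar mxE mxE big1 ?mulr0 // => l _.
  rewrite mxE; case: eqP => [E|_] /=; last by rewrite mulr0.
  by rewrite E ltnNge sa mulr0.
set M := g *m _ *m _ in H.
have E : (pid_mx b : 'M_n) *m M = (pid_mx b : 'M_n) *m M *m (pid_mx a : 'M_n).
  apply/matrixP=> r s; rewrite pidR [RHS]mxE (bigD1 s) //= big1 => [|l ls].
    rewrite pidR [pid_mx a _ _]mxE eqxx addr0 /=; case: ifP => [rb|_]; last by rewrite mul0r.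
    by case: ltnP => sa; rewrite ?mulr1 // mulr0 H.
  by rewrite [pid_mx a _ _]mxE val_eqE (negbTE ls) mulr0.
have := congr1 (fun X => X *m g) E; rewrite /= -!mulmxA mul_adj_mx !mulmxA mul_mx_scalar => E2.
rewrite /drops -(eqmx_scale _ (_ : \det g != 0)) -?unitfE // /lead E2 -mulmxA.
exact: submxMl.
Qed.

Hypothesis kn : (2 * k <= n)%N.
Hypothesis HI : valid_type n I.
Hypothesis Hw : is_rst n k I w.

Lemma in_closure_closed_cell g : g \in unitmx -> in_closure g -> closed_cell k I w g.
Proof.
move=> gu cg.
have drp a b q : (forall g' : 'M[C]_n, g' \in unitmx -> closed_cell k I w g' -> drops k g' a b q) ->
    drops k g a b q.
  move=> H; apply/dropsP => // r s rb sa.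
  apply: (in_closure_like (f := fun g => (g *m Nmx C n k ^+ q *m \adj g) r s) cg).
    apply: polyfun_like_mulmx => [i j|]; last exact: polyfun_like_adj.
    apply: (@polyfun_like_mulmx _ _ _ _ _ id) => {}i {}j; first exact: polyfun_like_coord.
    exact: polyfun_like_const.
  move=> g' u' c'; have /dropsP := H g' u' (cell_closed_cell kn HI Hw c').
  by apply.
split=> [a la la1|a la nla la2|a b ab|a la].
- by apply: drp => g' _ /cc_step1; apply.
- by apply: drp => g' _ /cc_step2; apply.
- by apply: drp => g' _ /cc_cup; apply.
apply/matrixP=> i j; rewrite [RHS]mxE.
apply: (in_closure_like (f := fun g => (lead g a *m Qmx C n k *m Nmx C n k ^+ bots w a) i j) cg).
  apply: polyfun_like_mulmx => {}i {}j; last exact: polyfun_like_const.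
  apply: polyfun_like_mulmx => {}i {}j; last exact: polyfun_like_const.
  apply: (polyfun_like_mulmx (B := id)) => {}i {}j; last exact: polyfun_like_coord.
  exact: polyfun_like_const.
by move=> g' u' c'; rewrite (cc_box (cell_closed_cell kn HI Hw c')) // mxE.
Qed.

End Closure.

(** * Deformations *)

Section StableBoxes.

Variables (C : fieldType) (n k : nat).
Hypothesis kn : (2 * k <= n)%N.

Notation N := (Nmx C n k).
Notation P := (Pmx C n k).
Notation Q := (Qmx C n k).
Notation box := (boxmx C n k).

(** P is a single Jordan block, so it has just one stable subspace of each dimension, the kernel of
    a power of N. *)
Lemma stable_P_box m (U : 'M[C]_(m, n)) : (U <= P)%MS -> (U *m N <= U)%MS ->
  (U == box (\rank U) 0)%MS.
Proof.
move=> UP UN; have rP : (\rank U <= n - k)%N by have [<- _] := rankPQ C kn; apply: mxrankS.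
have sU : (U <= box (\rank U) 0)%MS.
  rewrite -(boxP C kn (\rank U)) //; have UE : U *m P = U by apply/subPP.
  rewrite -[X in (X <= _)%MS]UE.
  by apply: submxMr; apply: ker_Nq; apply: nilpotent_stable.
rewrite sU /= -(geq_leqif (mxrank_leqif_sup sU)).
by apply: leq_trans (_ : (\rank U + 0 <= _)%N); rewrite ?rank_box // addn0.
Qed.

Lemma stable_Q_box m (U : 'M[C]_(m, n)) : (U <= Q)%MS -> (U *m N <= U)%MS ->
  (U == box 0 (\rank U))%MS.
Proof.
move=> UP UN; have rQ : (\rank U <= k)%N by have [_ <-] := rankPQ C kn; apply: mxrankS.
have sU : (U <= box 0 (\rank U))%MS.
  rewrite -(boxQ C kn (t := \rank U)) //; last by lia.
  have UE : U *m Q = U by apply/subQP.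
  rewrite -[X in (X <= _)%MS]UE.
  by apply: submxMr; apply: ker_Nq; apply: nilpotent_stable.
rewrite sU /= -(geq_leqif (mxrank_leqif_sup sU)).
by apply: leq_trans (_ : (0 + \rank U <= _)%N); rewrite ?rank_box.
Qed.

(** A stable subspace of P is an initial coordinate subspace, so a single vector in it bounds its
    dimension from below. *)
Lemma stable_P_rank m (U : 'M[C]_(m, n)) (j : 'I_n) (u : 'rV_n) :
  (U <= P)%MS -> (U *m N <= U)%MS -> (u <= U)%MS -> u 0 j != 0 -> (j < \rank U)%N.
Proof.
move=> UP UN uU; have /andP[s1 _] := stable_P_box UP UN.
have /sub_boxP H := submx_trans uU s1.
by apply: contraNT => nj; rewrite H //; lia.
Qed.

Lemma stable_Q_rank m (U : 'M[C]_(m, n)) (j : 'I_n) (u : 'rV_n) :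
  (U <= Q)%MS -> (U *m N <= U)%MS -> (u <= U)%MS -> u 0 j != 0 -> (j < n - k + \rank U)%N.
Proof.
move=> UP UN uU; have /andP[s1 _] := stable_Q_box UP UN.
have /sub_boxP H := submx_trans uU s1.
by apply: contraNT => nj; rewrite H //; lia.
Qed.

End StableBoxes.

Section Krylov.

Variables (C : fieldType) (n k : nat).

Notation N := (Nmx C n k).

Definition krylov c (u : 'rV[C]_n) : 'M[C]_(c, n) := \matrix_(s < c) (u *m N ^+ s).

Lemma krylov_sub c u s : (s < c)%N -> (u *m N ^+ s <= krylov c u)%MS.
Proof. by move=> sc; rewrite -[u *m _](rowK (fun s : 'I_c => u *m N ^+ s) (Ordinal sc)) row_sub. Qed.

Lemma krylov_subP c u m (U : 'M[C]_(m, n)) :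
  (forall s, (s < c)%N -> (u *m N ^+ s <= U)%MS) -> (krylov c u <= U)%MS.
Proof. by move=> H; apply/row_subP => s; rewrite rowK H. Qed.

Section Deformation.

Variables (c : nat) (L : 'M[C]_n) (e y : 'rV[C]_n).
Let E := krylov c e.
Let Y := krylov c y.
Let M := (L + (E + Y))%MS.
Hypothesis LN : (L *m N <= L)%MS.
Hypothesis eNc : (e *m N ^+ c <= L)%MS.
Hypothesis yNc : (y *m N ^+ c <= L)%MS.

(* The map of M / L sending [e N^s] to [y N^s] and killing [y N^s]. *)
Lemma ex_deformation : \rank M = (\rank L + (c + c))%N -> exists Psi : 'M[C]_n,
  [/\ L *m Psi = 0, forall s, (s < c)%N -> e *m N ^+ s *m Psi = y *m N ^+ s
    & forall s, (s < c)%N -> y *m N ^+ s *m Psi = 0].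
Proof.
move=> rM; pose B := col_mx (row_base L) (col_mx E Y).
have fB : row_free B.
  apply/eqP; rewrite -[RHS]rM; apply: eqmx_rank; apply/eqmxP.
  apply: eqmx_trans (eqmx_sym (addsmxE _ _)) _.
  exact: adds_eqmx (eq_row_base L) (eqmx_sym (addsmxE E Y)).
pose Psi := pinvmx B *m col_mx 0 (col_mx Y 0).
have : B *m Psi = col_mx 0 (col_mx Y 0) by rewrite mulmxA mulmxVp // mul1mx.
rewrite !mul_col_mx => /eq_col_mx[L0 /eq_col_mx[EY Y0]].
exists Psi; split.
- apply/eqP; rewrite -submx0 -(mul0mx _ Psi).
  have /submxP[X ->] : (L <= row_base L)%MS by rewrite eq_row_base.
  by rewrite -mulmxA L0 mulmx0 sub0mx.
- move=> s sc; have := congr1 (row (Ordinal sc)) EY.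
  by rewrite row_mul !rowK.
- move=> s sc; have := congr1 (row (Ordinal sc)) Y0.
  by rewrite row_mul !rowK row0.
Qed.

Variable Psi : 'M[C]_n.
Hypothesis LPsi : L *m Psi = 0.
Hypothesis ePsi : forall s, (s < c)%N -> e *m N ^+ s *m Psi = y *m N ^+ s.
Hypothesis yPsi : forall s, (s < c)%N -> y *m N ^+ s *m Psi = 0.

Let sub_L_Psi m (U : 'M[C]_(m, n)) : (U <= L)%MS -> U *m Psi = 0.
Proof. by case/submxP=> X ->; rewrite -mulmxA LPsi mulmx0. Qed.

Lemma deformation_stable : (M *m Psi <= M)%MS.
Proof.
rewrite addsmxMr addsmx_sub LPsi sub0mx addsmxMr addsmx_sub /=; apply/andP; split.
  apply/row_subP => s; rewrite row_mul rowK ePsi //.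
  apply: submx_trans (krylov_sub _ (ltn_ord s)) _.
  by apply: submx_trans (addsmxSr _ _); apply: addsmxSr.
by apply/row_subP => s; rewrite row_mul rowK yPsi // sub0mx.
Qed.

Lemma span_stable : (M *m N <= M)%MS.
Proof.
rewrite addsmxMr addsmx_sub (submx_trans LN (addsmxSl _ _)) addsmxMr addsmx_sub /=.
have kr u : (u *m N ^+ c <= L)%MS -> (krylov c u <= M)%MS -> (krylov c u *m N <= M)%MS.
  move=> uL uM; apply/row_subP => s; rewrite row_mul rowK -mulmxA -[N ^+ s *m N]exprSr.
  have [sc|sc] := ltnP s.+1 c; first exact: submx_trans (krylov_sub _ sc) uM.
  have -> : s.+1 = c by have := ltn_ord s; lia.
  exact: submx_trans uL (addsmxSl _ _).
by rewrite !kr //; apply: submx_trans (addsmxSr _ _); rewrite ?addsmxSl ?addsmxSr.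
Qed.

(** Below the last power both orders agree by construction; at the last one N leads into L, which
    [Psi] kills, while y N^c lies in L itself. *)
Lemma deformation_comm1 : (M *m (Psi *m N - N *m Psi) <= L)%MS.
Proof.
have kr u : (forall s, (s < c)%N -> (u *m N ^+ s *m (Psi *m N - N *m Psi) <= L)%MS) ->
    (krylov c u *m (Psi *m N - N *m Psi) <= L)%MS.
  by move=> H; apply/row_subP => s; rewrite row_mul rowK H.
have NS (u : 'rV_n) s : u *m N ^+ s *m N = u *m N ^+ s.+1 by rewrite exprSr -mulmxE mulmxA.
rewrite addsmxMr addsmx_sub mulmxBr !mulmxA LPsi mul0mx (sub_L_Psi LN) subrr sub0mx /=.
rewrite addsmxMr addsmx_sub; apply/andP; split; apply: kr => s sc.
- rewrite mulmxBr !mulmxA ePsi // !NS; have [sc'|sc'] := ltnP s.+1 c.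
    by rewrite ePsi // subrr sub0mx.
  have -> : s.+1 = c by lia.
  by rewrite (sub_L_Psi eNc) subr0.
- rewrite mulmxBr !mulmxA yPsi // mul0mx NS; have [sc'|sc'] := ltnP s.+1 c.
    by rewrite yPsi // subrr sub0mx.
  have -> : s.+1 = c by lia.
  by rewrite (sub_L_Psi yNc) subr0 sub0mx.
Qed.

Lemma deformation_comm q : (M *m (Psi *m N ^+ q - N ^+ q *m Psi) <= L)%MS.
Proof.
elim: q => [|q IH]; first by rewrite !expr0 mulmx1 mul1mx subrr mulmx0 sub0mx.
have -> : Psi *m N ^+ q.+1 - N ^+ q.+1 *m Psi =
    (Psi *m N ^+ q - N ^+ q *m Psi) *m N + N ^+ q *m (Psi *m N - N *m Psi).
  by rewrite exprSr -mulmxE mulmxBl mulmxBr !mulmxA addrA subrK.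
rewrite mulmxDr addmx_sub //.
  by rewrite mulmxA; apply: submx_trans (submxMr _ IH) LN.
rewrite mulmxA; apply: submx_trans (submxMr _ _) deformation_comm1.
elim: q {IH} => [|q IH]; first by rewrite expr0 mulmx1.
by rewrite exprSr -mulmxE mulmxA; apply: submx_trans (submxMr _ IH) span_stable.
Qed.

End Deformation.
End Krylov.

(** * Repairing the first level with too small an image *)

Section BadCup.

Variables (C : fieldType) (n k : nat) (I : seq nat) (w : tableau).
Hypothesis kn : (2 * k <= n)%N.
Hypothesis HI : valid_type n I.
Hypothesis Hw : is_rst n k I w.

Notation N := (Nmx C n k).
Notation P := (Pmx C n k).
Notation Q := (Qmx C n k).
Notation cupb := (black_cup n k I w).

(** The deformation along (a, b) moves the levels l with a < l <= b. The condition of (c, d)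
    involves levels c and d+1: both lie between a and b+1, or neither is moved. *)
Lemma cup_inside_or_outside a b c d : cupb a b -> cupb c d ->
  ((a <= c) /\ (d <= b) \/ ((c <= a) || (b < c)) /\ ((d < a) || (b <= d)))%N.
Proof.
move=> ab cd; have [/andP[ltab bn] _ _ _ _] := black_cupP kn HI Hw ab.
have [/andP[ltcd dn] _ _ _ _] := black_cupP kn HI Hw cd.
have /andP[_ ab'] := ab; have /andP[_ cd'] := cd.
have [ac|ca] := leqP a c.
  have [db|bd] := leqP d b; first by left.
  right; have [bc|cb] := ltnP b c; first by rewrite orbT; split=> //; lia.
  have [E|ne] := eqVneq a c.
    by rewrite -E in cd'; have := arch_right_uniq ab' cd'; lia.
  have [E|ne'] := eqVneq b c.
    by move: cd'; rewrite -E /arch_of (arch_asym _ ab').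
  by have := arch_noncrossing ab' cd'; lia.
right; split; first by rewrite ltnW.
have [//|ad] := ltnP d a; have [//|db] := leqP b d.
have [E|ne] := eqVneq a d.
  by move: ab'; rewrite E /arch_of (arch_asym _ cd').
by have := arch_noncrossing cd' ab'; lia.
Qed.

Variables (g : 'M[C]_n) (a b : nat).
Hypothesis gu : g \in unitmx.
Hypothesis cc : closed_cell k I w g.
Hypothesis ab : cupb a b.
Hypothesis ra : image_rank k g a = bots w a.
Hypothesis ra1 : image_rank k g a.+1 = bots w a.

Let c := (bots w b.+1 - bots w a)%N.
Let L := lead g a.
Let M := lead g b.+1.

Let cup_facts : [/\ [/\ (a < b)%N, (b < n)%N & (0 < c)%N], [/\ level I a, level I a.+1, level I b & level I b.+1],
  bots w b.+1 = (bots w a + c)%N, tops w b.+1 = (tops w a + c)%N & b.+1 = (a + (c + c))%N].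
Proof.
have [/andP[ltab bn] lv _ _ E] := black_cupP kn HI Hw ab.
have [sz le] := black_cup_size kn HI Hw ab.
by rewrite /c; split=> //; [split=> //|..]; lia.
Qed.

Let stable l : level I l -> (lead g l *m N <= lead g l)%MS.
Proof. exact: (closed_cell_stable kn HI Hw cc). Qed.

Let stableP l : level I l -> ((lead g l :&: P) *m N <= lead g l :&: P)%MS.
Proof.
move=> ll; rewrite sub_capmx (submx_trans (submxMr _ (capmxSl _ _)) (stable ll)) /=.
exact: submx_trans (submxMr _ (capmxSr _ _)) (PN_sub _ _ _).
Qed.

Let stableQ m (U : 'M[C]_(m, n)) : (U *m N <= U)%MS -> (U *m Q *m N <= U *m Q)%MS.
Proof. by move=> UN; rewrite -mulmxA comm_QN mulmxA; apply: submxMr. Qed.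

(** Although the image is too small at a+1, the cup condition forces the full value at b+1. *)
Let rank_b : image_rank k g b.+1 = bots w b.+1.
Proof.
have adm := closed_cell_admissible kn HI Hw gu cc.
have [[ltab bn c0] [_ _ _ lb] Eb Et Es] := cup_facts.
have [s1 s2] := adm_cup adm ab; rewrite -/c in s1 s2.
have s3 := adm_le adm lb; rewrite ra in s2; apply/eqP; rewrite eqn_leq s3 /= Eb.
by clear - s2 Es; lia.
Qed.

Let P_box l : level I l -> ((lead g l :&: P) == boxmx C n k (l - image_rank k g l) 0)%MS.
Proof.
move=> ll; rewrite (_ : (l - _)%N = \rank (lead g l :&: P)%MS).
  by apply: (stable_P_box kn (capmxSr _ _)); apply: stableP.
have := rank_split k (lead g l); rewrite rank_lead ?(level_le HI) // -/(image_rank k g l).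
by clear; lia.
Qed.

(** e is the last basis vector of M cap P and y a lift of the last one of rho(M). The span of L and
    their two Krylov spaces is stable, and by these vectors its parts in P and Q are as large as
    those of M, so it is M. As rho has not grown at a+1, F_{a+1} cap P has grown and contains e
    N^(c-1). *)
Lemma ex_cup_generators : exists e y : 'rV[C]_n,
  [/\ (e <= M)%MS /\ (e <= P)%MS, (y <= M)%MS,
      (e *m N ^+ c.-1 <= lead g a.+1)%MS,
      exists2 j : 'I_n, j = (n - k + bots w a)%N :> nat & (y *m N ^+ c.-1 *m Q) 0 j != 0
    & \rank (L + (krylov k c e + krylov k c y))%MS = (\rank L + (c + c))%N].
Proof.
have [[ltab bn c0] [la la1 lb lb1] Eb Et Es] := cup_facts.
have tb := tops_le Hw b.+1; have bb := bots_le Hw b.+1.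
have rL : \rank L = a by rewrite rank_lead // ltnW // (ltn_trans ltab).
have rM : \rank M = b.+1 by rewrite rank_lead.
(* The predecessors account for the numbering of the basis from zero. *)
have jeN : ((tops w b.+1).-1 < n)%N by clear - tb bn; lia.
have jfN : ((n - k + bots w b.+1).-1 < n)%N by clear - bb c0 Eb kn bn; lia.
pose je := Ordinal jeN; pose jf := Ordinal jfN.
pose e : 'rV[C]_n := delta_mx 0 je; pose f : 'rV[C]_n := delta_mx 0 jf.
have e_box : (e <= boxmx C n k (tops w b.+1) 0)%MS.
  apply/sub_boxP => i j nj; rewrite mxE (_ : (j == je) = false) ?andbF //.
  by apply/negP => /eqP E; move: nj; rewrite E /=; clear - c0 Et; lia.
have f_box : (f <= boxmx C n k 0 (bots w b.+1))%MS.
  apply/sub_boxP => i j nj; rewrite mxE (_ : (j == jf) = false) ?andbF //.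
  by apply/negP => /eqP E; move: nj; rewrite E /=; clear - c0 Eb; lia.
have /andP[_] := P_box lb1; rewrite rank_b.
rewrite (_ : (_ - _)%N = tops w b.+1); last first.
  by rewrite -{1}(tops_bots kn HI Hw lb1) addnK.
move=> /(submx_trans e_box); rewrite sub_capmx => /andP[eM eP].
have fMQ : (f <= M *m Q)%MS.
  have /andP[_] := stable_Q_box kn (submxMl M Q) (stableQ (stable lb1)).
  rewrite -[\rank _]/(image_rank k g b.+1) rank_b; exact: submx_trans.
have /submxP[X fX] := fMQ; pose y := X *m M.
have yM : (y <= M)%MS by exact: submxMl.
have yQ : y *m Q = f by rewrite fX mulmxA.
exists e, y; split=> //.
- have /andP[_] := P_box la1; rewrite ra1.
  rewrite sub_capmx => /andP[+ _]; apply: submx_trans.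
  apply: submx_trans (submxMr _ e_box) _.
  apply: submx_trans (box_Nq _ _ _ _) (box_mono _ kn _ _) => //.
  by have := tops_bots kn HI Hw la; clear - Et c0; lia.
- have jN : (n - k + bots w a < n)%N by clear - bb c0 Eb kn bn; lia.
  exists (Ordinal jN) => //.
  rewrite -mulmxA -comm_QNq mulmxA yQ mulNq /= ifT; last by clear - bb c0 Eb kn bn; lia.
  rewrite (_ : (_ + _)%N = jf); last by rewrite /= Eb; clear - c0; lia.
  by rewrite entryE mxE !eqxx oner_eq0.
set W := (L + _)%MS.
have pw u s : (u <= M)%MS -> (u *m N ^+ s <= M)%MS.
  move=> uM; elim: s => [|s IH]; first by rewrite expr0 mulmx1.
  by rewrite exprSr -mulmxE mulmxA; apply: submx_trans (submxMr _ IH) (stable lb1).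
have pc u : (u <= M)%MS -> (u *m N ^+ c <= L)%MS.
  by move=> uM; apply: submx_trans (submxMr _ uM) (cc_cup cc ab).
have WM : (W <= M)%MS.
  rewrite addsmx_sub lead_mono 1?ltnW ?(ltn_trans ltab) //= addsmx_sub.
  by apply/andP; split; apply: krylov_subP => s _; apply: pw.
have WN : (W *m N <= W)%MS by exact: (span_stable (stable la) (pc _ _ eM) (pc _ _ yM)).
apply/eqP; rewrite rL -Es eqn_leq -{1}rM mxrankS //= -(rank_split k W).
have eW : (e <= W :&: P)%MS.
  rewrite sub_capmx eP andbT; apply: submx_trans (addsmxSr _ _).
  by apply: submx_trans (addsmxSl _ _); rewrite -[X in (X <= _)%MS]mulmx1; apply: (krylov_sub _ _ (s := 0)).
have yW : (f <= W *m Q)%MS.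
  rewrite -yQ; apply: submxMr; apply: submx_trans (addsmxSr _ _).
  by apply: submx_trans (addsmxSr _ _); rewrite -[X in (X <= _)%MS]mulmx1; apply: (krylov_sub _ _ (s := 0)).
have h1 : (je < \rank (W :&: P)%MS)%N.
  apply: (stable_P_rank kn (capmxSr _ _) _ eW); last by rewrite mxE !eqxx oner_eq0.
  rewrite sub_capmx (submx_trans (submxMr _ (capmxSl _ _)) WN) /=.
  exact: submx_trans (submxMr _ (capmxSr _ _)) (PN_sub _ _ _).
have h2 : (jf < n - k + \rank (W *m Q))%N.
  apply: (stable_Q_rank kn (submxMl _ _) (stableQ WN) yW).
  by rewrite mxE !eqxx oner_eq0.
have := tops_bots kn HI Hw lb1; move: h1 h2; rewrite /=; clear - c0 Eb Et; lia.
Qed.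

Lemma ex_cup_deformation : exists H : 'M[C]_n, forall x, x != 0 -> g + x *: H \in unitmx ->
  [/\ closed_cell k I w (g + x *: H),
      forall l, (l <= a)%N -> lead (g + x *: H) l = lead g l
    & image_rank k (g + x *: H) a.+1 = bots w a.+1].
Proof.
have [[ltab bn c0] [la la1 lb lb1] Eb Et Es] := cup_facts.
have [e [y [[eM eP] yM ea1 [j jE yj] rW]]] := ex_cup_generators.
have pc u : (u <= M)%MS -> (u *m N ^+ c <= L)%MS.
  by move=> uM; apply: submx_trans (submxMr _ uM) (cc_cup cc ab).
have pw u s : (u <= M)%MS -> (u *m N ^+ s <= M)%MS.
  move=> uM; elim: s => [|s IH]; first by rewrite expr0 mulmx1.
  by rewrite exprSr -mulmxE mulmxA; apply: submx_trans (submxMr _ IH) (stable lb1).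
have [Psi [LPsi ePsi yPsi]] := ex_deformation rW.
set W := (L + _)%MS in rW.
have LM : (L <= M)%MS by apply: lead_mono; rewrite ltnW // (ltn_trans ltab).
have WM : (W <= M)%MS.
  by rewrite addsmx_sub LM addsmx_sub /=; apply/andP; split; apply: krylov_subP => s _; apply: pw.
have MW : (M <= W)%MS.
  rewrite -(geq_leqif (mxrank_leqif_sup WM)) rW !rank_lead //.
    by rewrite -Es.
  by rewrite ltnW // (ltn_trans ltab).
have MPsi : (M *m Psi <= M)%MS.
  apply: submx_trans (submxMr _ MW) _; apply: submx_trans WM.
  exact: (deformation_stable LPsi ePsi yPsi).
have comm q : (M *m (Psi *m N ^+ q - N ^+ q *m Psi) <= L)%MS.
  apply: submx_trans (submxMr _ MW) _.
  exact: (deformation_comm (stable la) (pc _ _ eM) (pc _ _ yM) LPsi ePsi yPsi).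
(* Only the first b+1 rows of [M] are nonzero: F_l is moved by 1 + x Psi for l <= b+1, and the later
   rows of the frame stay. *)
exists (M *m Psi) => x x0; set gx := g + _ => gxu.
have in_lead l : (l <= b.+1)%N -> lead gx l = lead g l *m (1%:M + x *: Psi).
  move=> lb'; rewrite [RHS]mulmxDr mulmx1 -scalemxAr.
  by rewrite [LHS]mulmxDr -scalemxAr mulmxA pid_lead.
have lowE l : (l <= a)%N -> lead gx l = lead g l.
  move=> la'; have lb' : (l <= b.+1)%N by clear - la' ltab; lia.
  rewrite in_lead // mulmxDr mulmx1 -scalemxAr.
  have /submxP[X ->] := lead_mono g la'.
  by rewrite -(mulmxA X) LPsi mulmx0 scaler0 addr0.
(* Levels up to a are fixed because [Psi] kills L, levels above b because it preserves M. *)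
have outE l : (l <= a)%N || (b < l)%N -> (l <= n)%N -> (lead gx l == lead g l)%MS.
  case/orP=> [la' _|lb' ln]; first by rewrite lowE // submx_refl.
  have s : (lead gx l <= lead g l)%MS.
    rewrite {1}/lead /gx mulmxDr addmx_sub // -scalemxAr scalemx_sub //.
    rewrite mulmxA; apply: submx_trans (lead_mono g lb'); apply: submx_trans MPsi.
    by apply: submxMr; rewrite /M {1}/lead mulmxA mul_pid_mx (minn_idPr lb') pid_mx_minv submx_refl.
  by rewrite s /= -(geq_leqif (mxrank_leqif_sup s)) !rank_lead.
have drop_out l1 l2 q : (l1 <= a)%N || (b < l1)%N -> (l2 <= a)%N || (b < l2)%N ->
    (l1 <= n)%N -> (l2 <= n)%N -> drops k g l1 l2 q -> drops k gx l1 l2 q.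
  move=> o1 o2 n1 n2 dr; have /andP[_ s1] := outE _ o1 n1; have /andP[s2 _] := outE _ o2 n2.
  exact: submx_trans (submxMr _ s2) (submx_trans dr s1).
(* 1 + x Psi commutes with N^q on M up to an error in L, and L is unmoved and contained in every
   level from a on. *)
have drop_in l1 l2 q : (a <= l1)%N -> (l1 <= b.+1)%N -> (l2 <= b.+1)%N ->
    drops k g l1 l2 q -> drops k gx l1 l2 q.
  move=> al1 lb1' lb2 dr; rewrite /drops in_lead //.
  have -> : lead g l2 *m (1%:M + x *: Psi) *m N ^+ q =
      lead g l2 *m N ^+ q *m (1%:M + x *: Psi) + x *: (lead g l2 *m (Psi *m N ^+ q - N ^+ q *m Psi)).
    rewrite mulmxBr scalerBr !mulmxDr !mulmx1 mulmxDl -!scalemxAr -scalemxAl !mulmxA -addrA.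
    by congr (_ + _); rewrite addrC subrK.
  rewrite addmx_sub //.
    by rewrite in_lead //; apply: submxMr.
  rewrite scalemx_sub //.
  apply: submx_trans (lead_mono gx al1); rewrite lowE //.
  by apply: submx_trans (submxMr _ (lead_mono g lb2)) (comm q).
have ccx : closed_cell k I w gx.
  split=> [l ll ll1|l ll nl ll2|l m lm|l ll].
  - have dr := cc_step1 cc ll ll1.
    have [la'|al] := leqP l.+1 a.
      by apply: drop_out; rewrite ?(level_le HI) //; clear - la'; lia.
    have [bl|lb'] := ltnP b l.
      by apply: drop_out; rewrite ?(level_le HI) //; clear - bl; lia.
    by apply: drop_in => //; clear - lb'; lia.
  - have dr := cc_step2 cc ll nl ll2.
    have nea : l.+1 != a by apply: contraNneq nl => ->.
    have neb : l != b by apply: contraNneq nl => ->.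
    have [la'|al] := leqP l.+2 a.
      by apply: drop_out; rewrite ?(level_le HI) //; clear - la'; lia.
    have [bl|lb'] := ltnP b l.
      by apply: drop_out; rewrite ?(level_le HI) //; clear - bl; lia.
    by apply: drop_in => //; clear - lb' nea neb al; lia.
  - have dr := cc_cup cc lm; have [lt [ll _ _ lm1] _ _ _] := black_cupP kn HI Hw lm.
    have [[al mb]|[o1 o2]] := cup_inside_or_outside ab lm.
      by apply: drop_in => //; clear - al mb lt; lia.
    by apply: drop_out; rewrite ?(level_le HI) //; clear - o1 o2; lia.
  - have [la'|al] := leqP l a; first by rewrite lowE // (cc_box cc).
    have [bl|lb'] := ltnP b l.
      have /andP[s _] : (lead gx l == lead g l)%MS.
        by apply: outE; rewrite ?bl ?orbT ?(level_le HI).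
      apply/eqP; rewrite -submx0 -(cc_box cc ll); apply: submxMr; apply: submxMr; exact: s.
    (* Between a and b the bound on rho is derived from the one at the unmoved level a, as N^(bots l
       - bots a) maps F_l into F_a. *)
    have [le dr] : (bots w a <= bots w l)%N /\ drops k g a l (bots w l - bots w a).
      apply: (chain_bots kn HI Hw (K := drops k g)) => //.
      + by move=> *; apply: drops0.
      + by move=> c1 c2 c3 q q' _ _ _; apply: dropsD.
      + exact: (cc_step1 cc).
      + exact: (cc_step2 cc).
      + exact: ltnW.
      move=> m /andP[am ml] um; have /andP[_ ab'] := ab.
      have nea : a != m.
        by apply/eqP => E; case/archP: ab' => _; rewrite E um.
      have [|||d ad dm] := nested_up kn HI Hw ab' _ _ _ um.
      * by clear; lia.
      * by clear - am nea ml lb'; lia.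
      * by clear - ml lb' bn; lia.
      exists d; split=> //; first by clear - ad; lia.
      exact: (cc_cup cc dm).
    have {}dr : drops k gx a l (bots w l - bots w a).
      by apply: drop_in => //; clear - lb' al; lia.
    rewrite -(subnK le) exprD -mulmxE mulmxA -(mulmxA (lead gx l)) comm_QNq mulmxA.
    apply/eqP; rewrite -submx0 -(cc_box cc la) -[lead g a](lowE a) //.
    by apply: submxMr; apply: submxMr.
split=> //.
have adm := closed_cell_admissible kn HI Hw gxu ccx.
have [_ _ [Ea _] _ _] := black_cupP kn HI Hw ab.
apply/eqP; rewrite eqn_leq (adm_le adm) //= Ea.
have stQ : (lead gx a.+1 *m Q *m N <= lead gx a.+1 *m Q)%MS.
  by apply: stableQ; apply: (closed_cell_stable kn HI Hw ccx).
(* Since e lies in P, the image of the moved vector e N^(c-1) under rho is x times that of y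
   N^(c-1); its nonzero coordinate at the next f supplies the missing dimension. *)
have sub : (x *: (y *m N ^+ c.-1 *m Q) <= lead gx a.+1 *m Q)%MS.
  have -> : x *: (y *m N ^+ c.-1 *m Q) = e *m N ^+ c.-1 *m (1%:M + x *: Psi) *m Q.
    have ltc : (c.-1 < c)%N by clear - c0; lia.
    rewrite mulmxDr mulmx1 -scalemxAr ePsi // mulmxDl -scalemxAl.
    rewrite -(mulmxA e) -comm_QNq mulmxA.
    have /subPP <- := eP; by rewrite -(mulmxA e P) mulPQ mulmx0 mul0mx add0r.
  by rewrite in_lead; [apply: submxMr; apply: submxMr|clear - ltab; lia].
have := stable_Q_rank kn (submxMl _ _) stQ sub (j := j).
rewrite mxE mulf_neq0 // => /(_ isT); rewrite jE -/(image_rank k gx a.+1).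
by clear; lia.
Qed.

End BadCup.

(** * Closures of cells *)

Section ClosureOfCell.

Variables (C : numFieldType) (n k : nat) (I : seq nat) (w : tableau).
Hypothesis kn : (2 * k <= n)%N.
Hypothesis HI : valid_type n I.
Hypothesis Hw : is_rst n k I w.

(* Descending induction on the first position where [dim (rho F_l)] is too small. *)
Lemma closed_cell_in_closure (g : 'M[C]_n) : g \in unitmx -> closed_cell k I w g ->
  in_closure k I w g.
Proof.
move=> gu cc.
(* m bounds the number of positions, counted down from n, at which the rank may still be wrong. *)
have [m] : exists m, forall l, level I l -> (l < n.+1 - m)%N -> image_rank k g l = bots w l.
  by exists n.+1; rewrite subnn.
elim: m g gu cc => [|m IH] g gu cc good p pp vp.
  apply: vp => //; apply: closed_cell_cell => // l ll; apply: good => //.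
  by rewrite subn0 ltnS (level_le HI).
set i := (n.+1 - m.+1)%N in good.
have adm := closed_cell_admissible kn HI Hw gu cc.
have next (g' : 'M[C]_n) : g' \in unitmx -> closed_cell k I w g' ->
    (forall l, level I l -> (l < i)%N -> image_rank k g' l = bots w l) ->
    (level I i -> image_rank k g' i = bots w i) -> p g' = 0.
  move=> gu' cc' good' goodi; apply: (IH g' gu' cc') => // l ll lt.
  have : (l <= i)%N by rewrite /i; lia.
  rewrite leq_eqVlt => /orP[/eqP E|]; last exact: good'.
  by rewrite E in ll *; apply: goodi.
have [li|nli] := boolP (level I i); last by apply: next => // li; rewrite li in nli.
have [Ei|ne] := eqVneq (image_rank k g i) (bots w i); first by apply: next.
have i0 : (0 < i)%N.
  rewrite lt0n; apply: contraNneq ne => ->.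
  by rewrite (adm0 adm) (bots0 kn HI Hw).
have lei := adm_le adm li.
have Pv := prev_levelP kn HI Hw i0 li; move: li ne good next lei; clear i0.
case: Pv => {i} a la Ea Et Eb li ne good next lei.
(* A wedge cannot be the first failure: [bots] stays the same and the rank does not decrease. *)
- case/eqP: ne; have [s1 s2] := adm_step1 adm la li; have ra := good a la (ltnSn a).
  by clear - s1 s2 ra lei Eb; lia.
- have ra := good a la (ltnSn a); have [s1 s2] := adm_step1 adm la li.
  have ra1 : image_rank k g a.+1 = bots w a.
    by move/eqP: ne; clear - s1 s2 ra lei Eb; lia.
  have an : (a < n)%N := level_le HI li.
  have aN : (n - k + a < 2 * n)%N by clear - an; lia.
  have [|t st] := ex_arch_right (height_nonneg kn HI Hw) (height_end kn HI Hw) aN.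
    by rewrite Ea.
  have lat : (n - k + a < t)%N by case/archP: st => /andP[].
  (* If the arch leads to a right outer point, all wedges from a+1 on belong to cups starting there
     or later, which forces the rank at a+1 up to [bots]. So the arch is a black cup. *)
  have [tr|tr] := leqP (2 * n - k) t.
    have : (bots w a.+1 <= image_rank k g a.+1)%N.
      apply: (admissible_bots_bound kn HI Hw adm li) => l lb ul.
      have [|||c sc cm] := nested_up kn HI Hw st _ _ _ ul.
      + by clear; lia.
      + by clear - lb tr kn; lia.
      + by case/andP: lb.
      by exists c => //; clear - sc; lia.
    by rewrite ra1 Eb ltnn.
  have ab : black_cup n k I w a (t - (n - k)).
    rewrite /black_cup /arch_of (_ : (n - k + (t - _))%N = t); last by clear - lat; lia.
    by rewrite st andbT; clear - tr lat kn; lia.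
  have [H HH] := ex_cup_deformation kn HI Hw gu cc ab ra ra1.
  apply: (polyfun_line_closure (H := H)) => // x x0 xu.
  have [cx low rx] := HH x x0 xu.
  apply: next => // l ll lta; rewrite -(good l ll lta) /image_rank low //.
- case/eqP: ne; have [s1 s2] := adm_step2 adm la Ea li; have ra := good a la (leqnSn a.+1).
  by clear - s1 s2 ra lei Eb; lia.
Qed.

Lemma Ytil_closed_cell (F : flag C n) (g : 'M[C]_n) : g \in unitmx -> flag_eq I (flag_of I g) F ->
  Ytil k I w F -> closed_cell k I w g.
Proof.
move=> gu gF [_ HF]; apply: in_closure_closed_cell => // p pp vp.
exact: HF pp vp g gu gF.
Qed.

Lemma closed_cell_eqmx (g h : 'M[C]_n) : (forall a, level I a -> (lead g a == lead h a)%MS) ->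
  closed_cell k I w g -> closed_cell k I w h.
Proof.
move=> gh cc.
have dr a b q : level I a -> level I b -> drops k g a b q -> drops k h a b q.
  move=> la lb d; have /andP[s1 _] := gh a la; have /andP[_ s2] := gh b lb.
  exact: submx_trans (submxMr _ s2) (submx_trans d s1).
split=> [a la la1|a la nla la2|a b ab|a la].
- by apply: dr => //; apply: (cc_step1 cc).
- by apply: dr => //; apply: (cc_step2 cc).
- have [_ [la _ _ lb] _ _ _] := black_cupP kn HI Hw ab.
  by apply: dr => //; apply: (cc_cup cc).
apply/eqP; rewrite -submx0 -(cc_box cc la); apply: submxMr; apply: submxMr.
by case/andP: (gh a la).
Qed.

Lemma closed_cell_Ytil (g : 'M[C]_n) : g \in unitmx -> closed_cell k I w g ->
  Ytil k I w (flag_of I g).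
Proof.
move=> gu cc; split; first by have [] := steps_inY kn HI Hw (cc_step1 cc) (cc_step2 cc) gu.
move=> p pp vp h hu hg; apply: (closed_cell_in_closure hu) => //.
apply: closed_cell_eqmx cc => a /levelP[[|l] ls <-]; first by rewrite !lead0 submx_refl.
by have := hg l.+1 ls; rewrite !flag_ofE andbC.
Qed.

End ClosureOfCell.

Lemma closures_meetP (C : numFieldType) (n k : nat) (I : seq nat) (w w' : tableau) :
  (2 * k <= n)%N -> valid_type n I -> is_rst n k I w -> is_rst n k I w' ->
  (exists F : flag C n, Ytil k I w F /\ Ytil k I w' F) <->
  exists v, [/\ outer_standard n k v, orients n k I w v & orients n k I w' v].
Proof.
move=> kn HI Hw Hw'; split=> [[F [HF HF']]|[v [vs vw vw']]].
  have [g gu gF] := is_flag_frame HI HF.1.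
  have gF' : flag_eq I (flag_of I g) F.
    by move=> [|l] // ls; rewrite flag_ofE; exact: gF ls.
  have aw := closed_cell_admissible kn HI Hw gu (Ytil_closed_cell kn HI Hw gu gF' HF).
  have aw' := closed_cell_admissible kn HI Hw' gu (Ytil_closed_cell kn HI Hw' gu gF' HF').
  exists (beta_orientation n k (image_rank k g)); split.
  - split=> s sl; rewrite /beta_orientation ?sl //.
    by case/andP: sl => s1 s2; rewrite ifN ?s1 //; lia.
  - exact: (admissible_orients kn HI Hw aw).
  - exact: (admissible_orients kn HI Hw' aw').
have aw := orients_admissible kn HI Hw vs vw.
have aw' := orients_admissible kn HI Hw' vs vw'.
(* This function depends on v and the type but on no tableau, so one coordinate flag serves both
   closures. *)
set beta := orientation_beta _ _ _ _ in aw aw'.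
pose F : flag C n := fun l => boxmx C n k (ii I l - beta (ii I l)) (beta (ii I l)).
have flF l : (l <= size I)%N -> fl F l = boxmx C n k (ii I l - beta (ii I l)) (beta (ii I l)).
  by case: l => // _; rewrite /= (adm0 aw) (box00 C kn).
have step l : (l < size I)%N -> (beta (ii I l) <= beta (ii I l.+1))%N /\
    (ii I l - beta (ii I l) <= ii I l.+1 - beta (ii I l.+1))%N.
  move=> ls; have ll := level_ii (ltnW ls); have ll1 := level_ii ls.
  have := gap_le2 kn HI Hw ls; have := ii_lt HI (ltnSn l) ls => lt le.
  have [E|E] : (ii I l.+1 = (ii I l).+1) \/ (ii I l.+1 = (ii I l).+2) by clear - lt le; lia.
    by have := adm_step1 aw ll; rewrite -E => /(_ ll1)[]; rewrite E; clear; lia.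
  have := adm_step2 aw ll; rewrite -E => -[] //; last by rewrite E; clear; lia.
  apply/negP => /levelP[l' ls' E'].
  have := ii_lt_inv HI (ltnW ls) ls'; have := ii_lt_inv HI ls' ls; clear - E E' lt; lia.
have Ff : is_flag I F.
  move=> l0; case: l0 => [//|l] ls; split.
    have [bk tk bl] := admissible_bounds kn HI Hw aw (level_ii ls).
    by rewrite (rank_boxE C kn tk bk) subnK.
  have [s1 s2] := step l ls.
  by rewrite [l.+1.-1]/= (flF l (ltnW ls)); exact: (box_mono C kn s2 s1).
have [g gu gF] := is_flag_frame HI Ff.
have gb a : level I a -> (lead g a == boxmx C n k (a - beta a) (beta a))%MS.
  by case/levelP=> l ls <-; rewrite -flF //; apply: gF.
exists (flag_of I g); split; apply: closed_cell_Ytil => //.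
  exact: (box_closed_cell kn HI Hw aw gb).
exact: (box_closed_cell kn HI Hw' aw' gb).
Qed.

Theorem theorem7p4 (R : realType) (n k : nat) (I : seq nat) (w w' : tableau) :
  (2 * k <= n)%N -> valid_type n I ->
  is_rst n k I w -> is_rst n k I w' ->
  ((forall F : flag R[i] n, ~ (Ytil k I w F /\ Ytil k I w' F))
   <-> has_red_circle n k I w w').
Proof.
move=> kn HI Hw Hw'; rewrite (red_circleP kn HI Hw Hw').
rewrite -(closures_meetP R[i] kn HI Hw Hw').
by split=> [H [F HF]|H F HF]; [apply: H HF|apply: H; exists F].
Qed.
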